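(* Let $\mathcal{C}\subset\mathbb{R}_+^{\mathcal{R}}$ be a capacity set. Suppose type-$r$ users ($r\in\mathcal{R}$) arrive according to independent Poisson processes with intensity $\nu_r>0$, and that type-$r$ service times are independent with a phase-type distribution given by a finite set of phases $I_r$, an initial probability distribution $(\alpha_{r,i})_{i\in I_r}$, exponential parameters $\mu_{r,i}>0$, and a substochastic phase transition matrix $P_r=(p_{r;ij})_{i,j\in I_r}$ with spectral radius strictly less than $1$. Let $\sigma_r$ be the mean service time of type-$r$ users and $\rho_r=\nu_r\sigma_r$. Let bandwidth be allocated according to proportional fairness as described in the context. If $\rho=(\rho_r)_{r\in\mathcal{R}}$ belongs to the interior of $\mathcal{C}$, then the process tracking the numbers of users in the system is ergodic.
   Context: $\mathcal{R}$ is a finite nonempty set. A capacity set is a set $\mathcal{C}\subset\mathbb{R}_+^{\mathcal{R}}$ that is compact, convex, nonincreasing (if $\lambda,\lambda'\in\mathbb{R}_+^{\mathcal{R}}$, $\lambda_r\le\lambda'_r$ for all $r$ and $\lambda'\in\mathcal{C}$, then $\lambda\in\mathcal{C}$), and contains a vector with all coordinates strictly positive. The interior of $\mathcal C$ is taken in $\mathbb{R}^{\mathcal{R}}$. Phase-type service: a type-$r$ service starts in phase $i$ with probability $\alpha_{r,i}$; each visit to phase $i$ requires an independent exponential amount of service with parameter $\mu_{r,i}$; a visit to phase $i$ is followed by a visit to phase $j$ with probability $p_{r;ij}$, and service ends after it with probability $1-\sum_j p_{r;ij}$. The service time is the sum of the service amounts over all visits, so $\sigma_r=\sum_{i,j\in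 I_r}\sum_{n\ge0}\alpha_{r,j}\,p_{r;ji}^{(n)}/\mu_{r,i}$, where $p^{(n)}_{r;ji}$ are the entries of $P_r^n$. Let $\widehat{\mathcal{R}}=\{(r,i): r\in\mathcal{R}, i\in I_r\}$ and let $x_{r,i}$ be the number of type-$r$ users currently in phase $i$; the number of type-$r$ users is $x_r=\sum_{i\in I_r}x_{r,i}$. Let $\widehat{\mathcal{C}}=\{(\lambda_{(r,i)})\in\mathbb{R}_+^{\widehat{\mathcal{R}}}: (\sum_{i\in I_r}\lambda_{(r,i)})_{r\in\mathcal{R}}\in\mathcal{C}\}$. For $x\in\mathbb{N}^{\widehat{\mathcal{R}}}$, $\lambda^{\mathrm{PF}}(x)$ is the maximizer of $\sum_{s\in\widehat{\mathcal{R}}}x_s\log\lambda_s$ over $\lambda\in\widehat{\mathcal{C}}$, with $\lambda^{\mathrm{PF}}_s(x)=0$ when $x_s=0$. (Equivalently, capacity is allocated to types by proportional fairness over $\mathcal{C}$ and shared equally among users of the same type.) The process $(x_{r,i})_{(r,i)\in\widehat{\mathcal{R}}}$ is the continuous-time Markov process on $\mathbb{N}^{\widehat{\mathcal{R}}}$ with transition rates ($e_{(r,i)}$ denoting unit vectors): $x\to x+e_{(r,i)}$ at rate $\nu_r\alpha_{r,i}$; $x\to x-e_{(r,i)}+e_{(r,j)}$ at rate $\mu_{r,i}\lambda^{\mathrm{PF}}_{(r,i)}(x)p_{r;ij}$; $x\to x-e_{(r,i)}$ at rate $\mu_{r,i}\lambda^{\mathrm{PF}}_{(r,i)}(x)(1-\sum_{j\in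 I_r}p_{r;ij})$. Ergodicity of the process of user numbers means that this Markov process, considered on the set of states reachable from the empty state, is irreducible and positive recurrent. *)

(* Defs.v *)
From HB Require Import structures.
From mathcomp Require Import all_boot all_order all_algebra.
From mathcomp Require Import complex.
From mathcomp Require Import all_classical all_reals all_analysis.

Set Implicit Arguments.
Unset Strict Implicit.
Unset Printing Implicit Defensive.

Import Order.TTheory GRing.Theory Num.Theory.
Import numFieldNormedType.Exports.

Local Open Scope classical_set_scope.
Local Open Scope ring_scope.

(** Vectors indexed by the finite type [I] are functions [I -> R]; as [I] is
    finite, the product topology [{ptws I -> R}] is the Euclidean one. *)
Record capacity_set (R : realType) (I : finType) (C : set {ptws I -> R}) :
    Prop := CapacitySet {
  capacity_ge0 : forall l, C l -> forall r, 0 <= l r;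
  capacity_compact : compact C;
  capacity_convex : convex_set (C : set (I -> R));
  capacity_down : forall l l' : I -> R,
    (forall r, 0 <= l r) -> (forall r, l r <= l' r) -> C l' -> C l;
  capacity_pos : exists2 l, C l & forall r, 0 < l r }.

(** Equal to the maximal modulus of a complex eigenvalue when [0 < n] (the set
    is then finite and nonempty), and to [sup set0 = 0] when [n = 0]. *)
Definition spectral_radius (R : realType) (n : nat) (A : 'M[R]_n) : R :=
  sup [set Normc.normc z |
       z in [set z : R[i] | eigenvalue (map_mx (real_complex R) A) z]].

(** The phases are ['I_(nphases d)], and [next_prob d i j] is the probability
    that a visit to phase [i] is followed by a visit to phase [j]. *)
Record phase_type (R : realType) := PhaseType {
  nphases : nat;
  start_prob : 'I_nphases -> R;
  service_rate : 'I_nphases -> R;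
  next_prob : 'M[R]_nphases;
  start_prob_ge0 : forall i, 0 <= start_prob i;
  start_prob_sum1 : \sum_i start_prob i = 1;
  service_rate_gt0 : forall i, 0 < service_rate i;
  next_prob_ge0 : forall i j, 0 <= next_prob i j;
  next_prob_sub : forall i, \sum_j next_prob i j <= 1;
  next_prob_radius : spectral_radius next_prob < 1 }.

Definition mean_service (R : realType) (d : phase_type R) : R :=
  \sum_(i < nphases d) \sum_(j < nphases d)
    limn (series (fun n =>
      start_prob j * (next_prob d ^+ n) j i / service_rate i)).

Section MarkovJumpProcess.
Context (R : realType) (S : choiceType).

(** [q x y], for [x != y], is the rate of the transitions from [x] to [y]; the
    diagonal values [q x x] are irrelevant. *)
Implicit Type q : S -> S -> R.

(** Intended for rates such that each state has finitely many successors
    (otherwise the finitely supported sum is [0]). *)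
Definition exit_rate q (x : S) : R := \sum_(y \in [set y | y != x]) q x y.

(** Used only when every exit rate is positive: absorbing states would need a
    different convention. *)
Definition jump_prob q (x y : S) : R :=
  if x == y then 0 else q x y / exit_rate q x.

Definition reachable q (x y : S) : Prop :=
  exists2 p : seq S,
    path (fun a b => (a != b) && (0 < q a b)) x p & last x p = y.

(** [X] is a continuous-time Markov process with rates [q] started at [x0], with
    jump chain [Y] and holding times [H]: [Y] is a Markov chain with transition
    matrix [jump_prob q], and given [Y] the [H k] are independent exponential
    variables with parameters [exit_rate q (Y k)]. Nothing is required of [X]
    after an explosion, i.e. at times beyond all the partial sums of [H]. *)
Record jump_process d (T : measurableType d) (P : probability T R) q (x0 : S)
    (X : R -> T -> S) (Y : nat -> T -> S) (H : nat -> T -> R) : Prop :=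
  JumpProcess {
  chain_measurable : forall k x, measurable [set w | Y k w = x];
  holding_measurable : forall k, measurable_fun setT (H k);
  holding_gt0 : forall k w, 0 < H k w;
  jump_law : forall (n : nat) (x : nat -> S) (t : nat -> R),
    (forall k, 0 <= t k) ->
    P [set w | forall k, (k <= n)%N -> Y k w = x k /\ t k < H k w] =
      ((x 0%N == x0)%:R * \prod_(k < n) jump_prob q (x k) (x k.+1)
        * \prod_(k < n.+1) expR (- (exit_rate q (x k) * t k)))%:E;
  jump_path : forall n t w,
    \sum_(k < n) H k w <= t < \sum_(k < n.+1) H k w -> X t w = Y n w }.

(** First time at which a path is in [x] after having been outside [x];
    [+oo] if there is no such time. *)
Definition return_time (T : Type) (X : R -> T -> S) (x : S) (w : T) : \bar R :=
  ereal_inf [set t%:E | t in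
    [set t | X t w = x /\ exists2 s, 0 <= s < t & X s w <> x]].

Definition positive_recurrent q (x : S) : Prop :=
  forall (d : measure_display) (T : measurableType d) (P : probability T R)
         (X : R -> T -> S) (Y : nat -> T -> S) (H : nat -> T -> R),
    jump_process P q x X Y H ->
    (\int[P]_w return_time X x w < +oo)%E.

Definition ergodic_from q (x0 : S) : Prop :=
  (forall x y, reachable q x0 x -> reachable q x0 y -> reachable q x y) /\
  (forall x, reachable q x0 x -> positive_recurrent q x).

End MarkovJumpProcess.

Section ProportionalFairness.
Context (R : realType) (I : finType) (svc : I -> phase_type R).

Definition user_phase : finType := {r : I & 'I_(nphases (svc r))}.
Definition state : Type := {ffun user_phase -> nat}.

Definition at_phase (r : I) (i : 'I_(nphases (svc r))) : user_phase :=
  Tagged (fun r => 'I_(nphases (svc r))) i.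
Arguments at_phase : clear implicits.

Definition unit_state (s : user_phase) : state :=
  [ffun s' => (s' == s) : nat].

Definition phase_capacity (C : set {ptws I -> R}) : set (user_phase -> R) :=
  [set l | (forall s, 0 <= l s) /\ C (fun r => \sum_i l (at_phase r i))].

(** With values in [\bar R]: [lne 0 = -oo], and [0 * -oo = 0], so that the
    coordinates with [x s = 0] do not contribute. *)
Definition pf_objective (x : state) (l : user_phase -> R) : \bar R :=
  (\sum_s (x s)%:R%:E * lne (l s)%:E)%E.

Definition is_pf (C : set {ptws I -> R}) (x : state) (l : user_phase -> R) :
    Prop :=
  [/\ phase_capacity C l, (forall s, x s = 0%N -> l s = 0) &
      forall l', phase_capacity C l' ->
        (pf_objective x l' <= pf_objective x l)%E].

(** The maximizer exists and is unique when [C] is a capacity set. *)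
Definition pf (C : set {ptws I -> R}) (x : state) : user_phase -> R :=
  xget (fun=> 0) [set l | is_pf C x l].

(** Total rate of the transitions from [x] to [y]; [y = x - e + e'] is expressed
    as [y + e = x + e'] to avoid truncated subtraction. *)
Definition pf_rate (C : set {ptws I -> R}) (nu : I -> R) (x y : state) : R :=
  let e r (i : 'I_(nphases (svc r))) := unit_state (at_phase r i) in
  \sum_(r : I) \sum_(i < nphases (svc r)) (
      (y == x + e r i)%:R * (nu r * start_prob i)
    + \sum_(j < nphases (svc r))
        (y + e r i == x + e r j)%:R
          * (service_rate i * pf C x (at_phase r i) * next_prob (svc r) i j)
    + (y + e r i == x)%:R
        * (service_rate i * pf C x (at_phase r i)
            * (1 - \sum_(j < nphases (svc r)) next_prob (svc r) i j))).

End ProportionalFairness.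

(* Main.v *)
(** Write [m] for the mean remaining service of a phase and [rho'] for the load
    of a phase when the arrival rates are slightly raised, so that every [rho']
    is positive and [(1 + eps) rho'] still belongs to the capacity set. The
    quadratic energy [sum_s (m_s / rho'_s) x_s ^ 2 / 2] has drift at most
    [K - c |x|]: within a type, where the bandwidth of phase [i] is [theta x_i],
    the inequalities [u_i u_j <= (u_i ^ 2 + u_j ^ 2) / 2] and
    [u_i <= (1 + u_i ^ 2) / 2] for [u_i = theta x_i / rho'_i], combined with the
    equations of [m] and [rho'], bound the drift by
    [(sum_i rho'_i) / theta - sum_i x_i] up to a constant, and the optimality
    condition of proportional fairness tested against [(1 + eps) rho'] makes the
    sum of these bounds over the types at most [- eps / (1 + eps) |x|].

    Foster's criterion then gives a finite mean return time to every state [o]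
    that can be reached from everywhere: subtracting from the energy a large
    multiple of a discounted hitting probability of [o] yields a function that
    decreases in mean at every state other than [o], which bounds the mean number
    of jumps before the return to [o]; exit rates being bounded below, the mean
    return time is finite too. *)

Require Import Defs.
From HB Require Import structures.
From mathcomp Require Import all_boot all_order all_algebra.
From mathcomp Require Import complex ring lra.
From mathcomp Require Import all_classical all_reals all_analysis.
From mathcomp Require Import measurable_realfun.

Set Implicit Arguments.
Unset Strict Implicit.
Unset Printing Implicit Defensive.

Import Order.TTheory GRing.Theory Num.Theory.
Import numFieldNormedType.Exports.
Local Open Scope classical_set_scope.
Local Open Scope ring_scope.

(** * Integrals and series in the extended reals *)

Section ExtendedReals.
Local Open Scope ereal_scope.
Context (R : realType).

Lemma nneseries_le_bound (u : nat -> \bar R) (M : \bar R) :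
  (forall n, 0 <= u n) -> (forall n, \sum_(i < n) u i <= M) ->
  \sum_(i <oo) u i <= M.
Proof.
move=> u0 uM; apply: lime_le; first exact: is_cvg_ereal_nneg_natsum.
by apply: nearW => n; rewrite big_mkord.
Qed.

Lemma partial_le_nneseries (u : nat -> \bar R) n :
  (forall n, 0 <= u n) -> \sum_(i < n) u i <= \sum_(i <oo) u i.
Proof.
by move=> u0; rewrite -(big_mkord xpredT u); apply: nneseries_lim_ge => // i _ _.
Qed.

Lemma nneseries_ge1_pinfty (u : nat -> \bar R) :
  (forall n, 1 <= u n) -> \sum_(i <oo) u i = +oo.
Proof.
move=> u1; apply/eqyP => a a0.
have [n an] : exists n, (a <= n%:R)%R.
  by exists (Num.truncn a).+1; exact/ltW/truncnS_gt.
have u0 i : 0 <= u i by exact: le_trans (u1 i).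
apply: le_trans (partial_le_nneseries n u0).
apply: (@le_trans _ _ (\sum_(i < n) 1)); last exact: lee_sum.
by rewrite sumEFin lee_fin big_const_ord iter_addr_0.
Qed.

(* No measurability of the smaller function is needed: the integral is a
   supremum over the simple functions below the integrand. *)
Lemma le_ge0_integral d (T : measurableType d) (mu : {measure set T -> \bar R})
    (f g : T -> \bar R) :
  (forall x, 0 <= f x) -> (forall x, f x <= g x) ->
  \int[mu]_x f x <= \int[mu]_x g x.
Proof.
move=> f0 fg; have g0 x : 0 <= g x by exact: le_trans (fg x).
rewrite !ge0_integralTE//; apply: ge_ereal_sup => _ [h hf <-].
by apply: ereal_sup_ubound; exists h => // x; exact: le_trans (fg x).
Qed.

Lemma le_measure_bigsetU d (T : measurableType d) (mu : {measure set T -> \bar R})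
    (I : Type) (s : seq I) (Q : pred I) (F : I -> set T) :
  (forall i, measurable (F i)) ->
  mu (\big[setU/set0]_(i <- s | Q i) F i) <= \sum_(i <- s | Q i) mu (F i).
Proof.
move=> mF; elim: s => [|i s IH]; first by rewrite !big_nil measure0.
rewrite !big_cons; case: ifP => // _.
have mU : measurable (\big[setU/set0]_(j <- s | Q j) F j).
  exact: bigsetU_measurable.
apply: le_trans (leeD (lexx _) IH).
exact: measureU2 (mF i) mU.
Qed.

End ExtendedReals.

(** * Positive recurrence of jump processes *)

Section JumpChain.
Context (R : realType) (S : choiceType) (q : S -> S -> R) (succ : S -> seq S).
Hypothesis succ_uniq : forall x, uniq (succ x).
Hypothesis succ_irr : forall x, x \notin succ x.
Hypothesis succ_rate : forall x y, y != x -> y \notin succ x -> q x y = 0.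
Hypothesis rate_ge0 : forall x y, 0 <= q x y.

Lemma exit_rateE x : exit_rate q x = \sum_(y <- succ x) q x y.
Proof.
rewrite /exit_rate [RHS]fsbig_seq//; apply/esym.
rewrite (fsbig_widen [set` succ x] [set y | y != x])//.
- by move=> y /= ys; apply: contraNneq (succ_irr x) => yx; rewrite -{1}yx.
- by move=> y /= [yx /negP ys]; exact: succ_rate.
Qed.

Context (delta : R).
Hypothesis delta_gt0 : 0 < delta.
Hypothesis exit_ge : forall x, delta <= exit_rate q x.

Lemma exit_rate_gt0 x : 0 < exit_rate q x.
Proof. exact: lt_le_trans (exit_ge x). Qed.

Lemma jump_prob_ge0 x y : 0 <= jump_prob q x y.
Proof.
rewrite /jump_prob; case: ifP => // _.
by apply: divr_ge0 => //; exact/ltW/exit_rate_gt0.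
Qed.

Lemma sum_jump_prob x (f : S -> R) :
  \sum_(y <- succ x) jump_prob q x y * f y =
  (\sum_(y <- succ x) q x y * f y) / exit_rate q x.
Proof.
rewrite mulr_suml big_seq [RHS]big_seq; apply: eq_bigr => y ys.
rewrite /jump_prob ifN; first by rewrite mulrAC.
by apply: contraNneq (succ_irr x) => xy; rewrite {1}xy.
Qed.

Lemma sum_jump_prob1 x : \sum_(y <- succ x) jump_prob q x y = 1.
Proof.
under eq_bigr do rewrite -[jump_prob _ _ _]mulr1.
rewrite sum_jump_prob; under eq_bigr do rewrite mulr1.
by rewrite -exit_rateE divff// gt_eqF// exit_rate_gt0.
Qed.

(** Probability that the jump chain started in [z], which may be [o] itself,
    makes [m] steps all ending outside [o]. *)
Fixpoint taboo (o : S) (m : nat) (z : S) : R :=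
  if m is m'.+1 then
    \sum_(y <- succ z | y != o) jump_prob q z y * taboo o m' y
  else 1.

Lemma taboo_ge0 o m z : 0 <= taboo o m z.
Proof.
elim: m z => //= m IH z; apply: sumr_ge0 => y _.
by apply: mulr_ge0 => //; exact: jump_prob_ge0.
Qed.

(** The [taboo o k o] are the tail probabilities of the number of jumps before a return to [o], so
    their sum is its mean. Induction on the horizon bounds the mean number of jumps from [z != o] by
    [U z + B]; one more first-step decomposition treats the start in [o]. *)
Lemma taboo_sum_le (o : S) (U : S -> R) (B : R) :
  (forall z, 0 <= U z + B) ->
  (forall z, z != o -> \sum_(y <- succ z) jump_prob q z y * U y <= U z - 1) ->
  forall n, \sum_(k < n) taboo o k o <=
    1 + \sum_(y <- succ o) jump_prob q o y * (U y + B).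
Proof.
move=> UB drift.
have step z n : (forall y, y != o -> \sum_(k < n) taboo o k y <= U y + B) ->
    \sum_(k < n.+1) taboo o k z <=
    1 + \sum_(y <- succ z) jump_prob q z y * (U y + B).
  move=> IH; rewrite big_ord_recl lerD2l.
  rewrite (eq_bigr (fun k : 'I_n => \sum_(y <- succ z | y != o)
    jump_prob q z y * taboo o k y))//.
  rewrite exchange_big/= big_mkcond/=; apply: ler_sum => y _.
  have [_|yo] := eqVneq y o; first by rewrite mulr_ge0 ?jump_prob_ge0.
  by rewrite -mulr_sumr ler_wpM2l ?jump_prob_ge0 ?IH.
have main n : forall z, z != o -> \sum_(k < n) taboo o k z <= U z + B.
  elim: n => [z _|n IH z zo]; first by rewrite big_ord0.
  apply: le_trans (step z n IH) _.
  under eq_bigr do rewrite mulrDr.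
  rewrite big_split/= -mulr_suml sum_jump_prob1 mul1r addrA lerD2r.
  by rewrite addrC -lerBrDr drift.
case=> [|n]; last exact: step (@main n).
rewrite big_ord0 addr_ge0//; apply: sumr_ge0 => y _.
by rewrite mulr_ge0 ?jump_prob_ge0.
Qed.

(** * Mean return time of a jump process *)

Section JumpProcess.
Context (d : measure_display) (T : measurableType d) (P : probability T R).
Context (o : S) (X : R -> T -> S) (Y : nat -> T -> S) (H : nat -> T -> R).
Hypothesis XYH : jump_process P q o X Y H.

Let path_event (x : nat -> S) n : set T :=
  [set w | forall k, (k <= n)%N -> Y k w = x k].

Let path_weight (x : nat -> S) n : R :=
  (x 0%N == o)%:R * \prod_(k < n) jump_prob q (x k) (x k.+1).

Let extend (x : nat -> S) n y : nat -> S := fun k => if (k <= n)%N then x k else y.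

Let path_eventS x n y :
  path_event (extend x n y) n.+1 = path_event x n `&` [set w | Y n.+1 w = y].
Proof.
apply/seteqP; split => w /=.
  move=> h; split => [k kn|]; first by rewrite h ?leqW// /extend kn.
  by rewrite h// /extend ltnn.
move=> [h hy] k; rewrite leq_eqVlt => /predU1P[->|]; first by rewrite /extend ltnn.
by rewrite ltnS /extend => kn; rewrite kn h.
Qed.

Let path_weightS x n y :
  path_weight (extend x n y) n.+1 = path_weight x n * jump_prob q (x n) y.
Proof.
rewrite /path_weight big_ord_recr/= mulrA /extend leqnn ltnn leq0n.
congr (_ * _ * _); apply: eq_bigr => k _.
by rewrite ltnW// (ltn_ord k).
Qed.

Let measurable_path_event x n : measurable (path_event x n).
Proof.
have -> : path_event x n = \bigcap_(k in [set k | (k <= n)%N]) [set w | Y k w = x k].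
  by apply/seteqP; split => w.
by apply: bigcap_measurable => [|k _]; [exists 0%N|exact: (chain_measurable XYH)].
Qed.

(** Holding times are positive, so zero thresholds in [jump_law] cost nothing and only the one at
    step [n] is kept. *)
Let measure_path_holding x n (j : R) : 0 <= j ->
  P (path_event x n `&` [set w | j < H n w]) =
  (path_weight x n * expR (- (exit_rate q (x n) * j)))%:E.
Proof.
move=> j0; pose t k : R := if k == n then j else 0.
have t0 k : 0 <= t k by rewrite /t; case: ifP.
have et : \prod_(k < n.+1) expR (- (exit_rate q (x k) * t k)) =
    expR (- (exit_rate q (x n) * j)).
  rewrite big_ord_recr/= big1 ?mul1r/t ?eqxx// => k _.
  by rewrite ltn_eqF// mulr0 oppr0 expR0.
have := jump_law XYH n x t0; rewrite et -/(path_weight x n) => <-; congr (P _); apply/seteqP; split => w /=.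
  move=> [h hj] k kn; split; first exact: h.
  by rewrite /t; case: eqP => [->//|_]; exact: (holding_gt0 XYH).
move=> h; split => [k kn|]; first by have [] := h k kn.
by have [_] := h n (leqnn n); rewrite /t eqxx.
Qed.

Let measure_path_event x n : P (path_event x n) = (path_weight x n)%:E.
Proof.
have := measure_path_holding x n (lexx 0); rewrite mulr0 oppr0 expR0 mulr1 => <-.
congr (P _); apply/esym/setIidPl => w _ /=; exact: (holding_gt0 XYH).
Qed.

(** The jump probabilities towards [succ (x n)] sum to one, so the listed extensions carry the whole
    mass of the path. *)
Let null_unlisted x n :
  P (path_event x n `\` \big[setU/set0]_(y <- succ (x n))
      path_event (extend x n y) n.+1) = 0%E.
Proof.
pose U := \big[setU/set0]_(y <- succ (x n)) path_event (extend x n y) n.+1.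
have mU : measurable U by apply: bigsetU_measurable => y _.
have fin : (P (path_event x n) < +oo)%E by rewrite measure_path_event ltry.
have UE : path_event x n `&` U = U.
  apply/setIidPr; rewrite /U; apply: (big_ind (fun A => A `<=` path_event x n)) => //.
    by move=> A B hA hB w [/hA|/hB].
  by move=> y _ w; rewrite path_eventS => -[].
transitivity (P (path_event x n) - P U)%E.
  by rewrite -[in RHS]UE; exact: measureD.
have -> : P U = (\sum_(y <- succ (x n)) path_weight (extend x n y) n.+1)%:E.
  rewrite /U -bigcup_seq measure_fin_bigcup//; first last.
  - by move=> y z _ _ [w []]; rewrite !path_eventS => -[_ /= <-] [_ /= <-].
  rewrite -fsbig_seq// -sumEFin; apply: eq_bigr => y _.
  exact: measure_path_event.
under eq_bigr do rewrite path_weightS.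
by rewrite -mulr_sumr sum_jump_prob1 mulr1 measure_path_event subee.
Qed.

Let avoid_event x n m (j : R) : set T :=
  path_event x n `&` [set w | (forall k, (n < k <= n + m)%N -> Y k w <> o) /\
                              j < H (n + m)%N w].

Let measurable_avoid_event x n m j : measurable (avoid_event x n m j).
Proof.
apply: measurableI => //.
have -> : [set w | (forall k, (n < k <= n + m)%N -> Y k w <> o) /\
                   j < H (n + m)%N w] =
  (\bigcap_(k in [set k | (n < k <= n + m)%N]) ~` [set w | Y k w = o]) `&`
  (H (n + m)%N @^-1` `]j, +oo[%classic).
  apply/seteqP; split => w /= [h hj]; split => //.
    by move: hj; rewrite in_itv/= andbT.
  by move: hj; rewrite in_itv/= andbT.
apply: measurableI; last first.
  by rewrite -[X in measurable X]setTI; exact: (holding_measurable XYH).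
apply: bigcap_measurableType => k _; apply: measurableC.
exact: (chain_measurable XYH).
Qed.

(** Induction on [m]: up to a null set, the next jump leads to a listed successor other than [o],
    which is the recursion of [taboo]. The bound [delta] on exit rates gives the exponential tail of
    the last holding time. *)
Let measure_avoid_event m x n (j : R) : 0 <= j ->
  (P (avoid_event x n m j) <=
   (path_weight x n * taboo o m (x n) * expR (- (delta * j)))%:E)%E.
Proof.
move=> j0; elim: m x n => [|m IH] x n.
  have -> : avoid_event x n 0 j = path_event x n `&` [set w | j < H n w].
    rewrite /avoid_event addn0; congr (_ `&` _).
    apply/seteqP; split => w /=; first by case.
    by move=> h; split => // k; rewrite ltnNge andNb.
  rewrite measure_path_holding//= mulr1 lee_fin ler_wpM2l//.
    by rewrite /path_weight mulr_ge0// prodr_ge0// => k _; exact: jump_prob_ge0.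
  by rewrite ler_expR lerN2 ler_wpM2r.
pose A := \big[setU/set0]_(y <- succ (x n) | y != o)
  avoid_event (extend x n y) n.+1 m j.
pose B := path_event x n `\` \big[setU/set0]_(y <- succ (x n))
  path_event (extend x n y) n.+1.
have mA : measurable A by apply: bigsetU_measurable => y _.
have mB : measurable B.
  by apply: measurableD => //; apply: bigsetU_measurable => y _.
have sub : avoid_event x n m.+1 j `<=` A `|` B.
  move=> w [hx [ho hj]].
  have [ys|ys] := boolP (Y n.+1 w \in succ (x n)).
    left; rewrite /A -bigcup_seq_cond; exists (Y n.+1 w) => /=.
      by rewrite ys; apply/eqP; apply: ho; rewrite ltnSn addnS ltnS leq_addr.
    split; first by rewrite path_eventS.
    split; last by rewrite addSnnS.
    by move=> k /andP[nk kn]; apply: ho; rewrite -addSnnS kn ltnW.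
  right; split => //; rewrite -bigcup_seq => -[y /= ys'].
  by rewrite path_eventS => -[_ /= Yy]; move: ys; rewrite Yy ys'.
have leAB : (P (avoid_event x n m.+1 j) <= P A + P B)%E.
  apply: (@le_trans _ _ (P (A `|` B))); last exact: measureU2.
  by apply: le_measure; rewrite ?inE//; exact: measurableU.
apply: le_trans leAB _; rewrite [P B]null_unlisted adde0.
apply: le_trans (le_measure_bigsetU _ _ _ _) _; first by [].
rewrite /= mulr_sumr mulr_suml -sumEFin; apply: lee_sum => y yo.
apply: le_trans (IH _ _) _.
by rewrite path_weightS /extend ltnn lee_fin !mulrA.
Qed.

(** Adding this null set to every [avoid] set makes the sum of the counts infinite on it, so that
    the bound on the return time holds at every outcome. *)
Let null_event : set T :=
  ~` path_event (fun=> o) 0 `|` path_event (fun=> o) 1.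

Let measurable_null_event : measurable null_event.
Proof. by apply: measurableU => //; exact: measurableC. Qed.

Let path_weight0 : path_weight (fun=> o) 0 = 1.
Proof. by rewrite /path_weight eqxx big_ord0 mulr1. Qed.

Let null_event_null : P null_event = 0%E.
Proof.
apply/eqP; rewrite eq_le measure_ge0 andbT.
apply: (@le_trans _ _ (P (~` path_event (fun=> o) 0) + P (path_event (fun=> o) 1))%E).
  by apply: measureU2 => //; exact: measurableC.
rewrite probability_setC// !measure_path_event path_weight0 subee// add0e.
by rewrite /path_weight big_ord_recr/= /jump_prob eqxx !mulr0.
Qed.

Let avoid k (j : nat) : set T := avoid_event (fun=> o) 0 k j%:R `|` null_event.

Let measurable_avoid k j : measurable (avoid k j).
Proof. exact: measurableU. Qed.

Let measure_avoid k j :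
  (P (avoid k j) <= (taboo o k o * expR (- delta) ^+ j)%:E)%E.
Proof.
rewrite -[leRHS]adde0 -null_event_null.
apply: (@le_trans _ _ (P (avoid_event (fun=> o) 0 k j%:R) + P null_event)%E).
  exact: measureU2.
rewrite leeD2r//; apply: le_trans (measure_avoid_event _ _ _ _) _ => //.
by rewrite path_weight0 mul1r -expRM_natl mulrN [delta * _]mulrC.
Qed.

(** Outside [null_event], this is the ceiling of [H k w] if the chain has not returned to [o] by
    step [k], and zero otherwise. Its mean is bounded by a geometric series. *)
Let count k w : \bar R := (\sum_(j <oo) (\1_(avoid k j) w)%:E)%E.

Let indic_ge0 k j w : (0 <= (\1_(avoid k j) w)%:E :> \bar R)%E.
Proof. by rewrite lee_fin. Qed.

Let count_ge0 k w : (0 <= count k w)%E.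
Proof. exact: nneseries_ge0. Qed.

Let sum_count_pinfty w :
  (forall k, w \in avoid k 0) -> (\sum_(k <oo) count k w = +oo)%E.
Proof.
move=> wk; apply: nneseries_ge1_pinfty => k.
apply: le_trans (partial_le_nneseries 1 (indic_ge0 k ^~ w)).
by rewrite big_ord_recl big_ord0 adde0 indicE wk.
Qed.

Let holding_le_count k w : (forall i, (0 < i <= k)%N -> Y i w <> o) ->
  path_event (fun=> o) 0 w -> ((H k w)%:E <= count k w)%E.
Proof.
move=> hY h0.
have ex : exists n, (H k w <= n%:R).
  by exists (Num.truncn (H k w)).+1; exact/ltW/truncnS_gt.
have /= := ex_minnP ex; case=> n Hn nmin.
apply: le_trans (partial_le_nneseries n (indic_ge0 k ^~ w)).
rewrite (eq_bigr (fun=> 1%:E)); last first.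
  move=> j _; rewrite indicE mem_set//; left; split => //; split => //.
  by rewrite ltNge; apply/negP => /nmin; rewrite leqNgt ltn_ord.
by rewrite sumEFin lee_fin big_const_ord iter_addr_0.
Qed.

(** If the chain first returns at step [n], the return time is at most the sum of the first [n]
    holding times. On [null_event], or without any return, the right-hand side is infinite. *)
Let return_time_le w : (return_time X o w <= \sum_(k <oo) count k w)%E.
Proof.
have [wZ|wZ] := pselect (null_event w).
  by rewrite sum_count_pinfty ?leey// => k; rewrite mem_set//; right.
have h0 : path_event (fun=> o) 0 w by apply: contrapT => h; apply: wZ; left.
have Y0 : Y 0%N w = o by exact: h0.
have Y1 : Y 1%N w <> o.
  by move=> h1; apply: wZ; right => -[_|[_|//]].
have [ex|nex] := pselect (exists n, (0 < n)%N && (Y n w == o)); last first.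
  rewrite sum_count_pinfty ?leey// => k; rewrite mem_set//; left; split => //; split.
    by move=> i /andP[i0 _] /eqP Yi; apply: nex; exists i; rewrite i0.
  exact: (holding_gt0 XYH).
have /= := ex_minnP ex; case=> n /andP[n0 /eqP Yn] nmin.
have hH k : 0 < H k w by exact: (holding_gt0 XYH).
have n2 : (1 < n)%N.
  by rewrite ltn_neqAle n0 andbT; apply/eqP => n1; apply: Y1; rewrite n1.
apply: (@le_trans _ _ (\sum_(k < n) H k w)%:E).
  apply: ereal_inf_lbound => /=; exists (\sum_(k < n) H k w) => //; split.
    rewrite (jump_path XYH (n := n))//.
    by rewrite lexx/= big_ord_recr/= ltrDl.
  (* At the first jump time the path is in [Y 1], hence outside [o]; since [n] exceeds one, this
     time precedes the return. *)
  exists (H 0%N w); last first.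
    rewrite (jump_path XYH (n := 1))// !big_ord_recr !big_ord0/= !add0r lexx/=.
    by rewrite ltrDl.
  rewrite ltW//=; case: (n) n2 => [|[|m]]// _.
  rewrite 2!big_ord_recl/= ltrDl ltr_wpDr//.
  by apply: sumr_ge0 => k _; exact: ltW.
apply: le_trans (partial_le_nneseries n (count_ge0 ^~ w)).
rewrite -sumEFin; apply: lee_sum => k _; apply: holding_le_count => //.
move=> i /andP[i0 ik] /eqP Yi; have := nmin i; rewrite i0 Yi => /(_ isT).
by rewrite leqNgt (leq_ltn_trans ik).
Qed.

(** The mean of [count k] is at most [taboo o k o] times the geometric series of ratio
    [expR (- delta)]; summed over [k], this is at most [M] times that series. *)
Lemma return_time_integrable (M : R) :
  (forall n, \sum_(k < n) taboo o k o <= M) ->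
  (\int[P]_w return_time X o w < +oo)%E.
Proof.
move=> hM; have r1 : expR (- delta) < 1 by rewrite -expR0 ltr_expR oppr_lt0.
have geo n : \sum_(j < n) expR (- delta) ^+ j <= (1 - expR (- delta))^-1.
  rewrite -[leRHS]mul1r ler_pdivlMr ?subr_gt0// mulrC.
  rewrite -[1 - _]opprB mulNr -subrX1 opprB lerBlDr lerDl.
  by rewrite exprn_ge0// expR_ge0.
have M0 : 0 <= M by have := hM 0%N; rewrite big_ord0.
apply: (@le_lt_trans _ _ (\int[P]_w (\sum_(k <oo) count k w))%E).
  apply: le_ge0_integral return_time_le => w.
  apply: le_ereal_inf_tmp => _ [t [_ [s /andP[s0 st] _]] <-].
  by rewrite lee_fin (le_trans s0)// ltW.
have mindic k j : measurable_fun [set: T] (@EFin R \o \1_(avoid k j)).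
  exact/measurable_EFinP/measurable_indic.
have mcount k : measurable_fun setT (count k).
  apply: (ge0_emeasurable_sum (P := xpredT)) => [j w _ _|j _].
    exact: indic_ge0.
  exact: mindic.
rewrite integral_nneseries//.
have int_count k : (\int[P]_w count k w <=
    (taboo o k o * (1 - expR (- delta))^-1)%:E)%E.
  rewrite (@integral_nneseries _ T R P setT measurableT
    (fun j w => (\1_(avoid k j) w)%:E) (mindic k))//.
  apply: nneseries_le_bound => [j|n].
    by apply: integral_ge0 => w _; rewrite lee_fin.
  apply: (@le_trans _ _ (\sum_(j < n) (taboo o k o * expR (- delta) ^+ j)%:E)%E).
    by apply: lee_sum => j _; rewrite integral_indic// setIT; exact: measure_avoid.
  by rewrite sumEFin -mulr_sumr lee_fin ler_wpM2l// taboo_ge0.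
apply: (@le_lt_trans _ _ (M * (1 - expR (- delta))^-1)%:E); last by rewrite ltry.
apply: nneseries_le_bound => [k|n]; first by apply: integral_ge0.
apply: (@le_trans _ _
  (\sum_(k < n) (taboo o k o * (1 - expR (- delta))^-1)%:E)%E).
  exact: lee_sum.
by rewrite sumEFin -mulr_suml lee_fin ler_wpM2r// invr_ge0 subr_ge0 ltW.
Qed.

End JumpProcess.

(* Weighting the hitting probabilities by [2 ^- (number of steps)] makes them
   subharmonic with a strictly positive gap wherever they are positive. *)
Fixpoint discounted_hit (o : S) (n : nat) (z : S) : R :=
  if z == o then 1 else
  if n is n'.+1 then
    (\sum_(y <- succ z) jump_prob q z y * discounted_hit o n' y) / 2
  else 0.

Let discounted_hit_rec o n z : discounted_hit o n.+1 z =
  if z == o then 1 else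
    (\sum_(y <- succ z) jump_prob q z y * discounted_hit o n y) / 2.
Proof. by []. Qed.

Lemma discounted_hit_ge0 o n z : 0 <= discounted_hit o n z.
Proof.
elim: n z => [|n IH] z /=; case: ifP => // _.
rewrite divr_ge0//; apply: sumr_ge0 => y _.
by rewrite mulr_ge0 ?jump_prob_ge0.
Qed.

Lemma discounted_hit_le1 o n z : discounted_hit o n z <= 1.
Proof.
elim: n z => [|n IH] z /=; case: ifP => // _.
rewrite ler_pdivrMr// mul1r (@le_trans _ _ 1) ?ler1n//.
rewrite -(sum_jump_prob1 z); apply: ler_sum => y _.
by rewrite ler_piMr ?jump_prob_ge0.
Qed.

Lemma discounted_hitS o n z : discounted_hit o n z <= discounted_hit o n.+1 z.
Proof.
elim: n z => [|n IH] z.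
  rewrite /=; case: ifP => // _; rewrite divr_ge0//; apply: sumr_ge0 => y _.
  by rewrite mulr_ge0 ?jump_prob_ge0//; case: ifP.
rewrite discounted_hit_rec [leRHS]discounted_hit_rec; case: ifP => // _.
rewrite ler_pM2r ?invr_gt0//; apply: ler_sum => y _.
by rewrite ler_wpM2l ?jump_prob_ge0//; exact: IH.
Qed.

Lemma discounted_hit_homo o z :
  {homo (fun n => discounted_hit o n z) : m n / (m <= n)%N >-> m <= n}.
Proof. by apply: homo_leq => [//|? ? ?|n]; [exact: le_trans|exact: discounted_hitS]. Qed.

Lemma discounted_hit_gt0 o z : reachable q z o ->
  exists n, 0 < discounted_hit o n z.
Proof.
case=> p; elim: p z => [|y p IH] z /=; first by move=> _ ->; exists 0%N; rewrite /= eqxx.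
move=> /andP[/andP[zy qzy] hp] /(IH _ hp)[n hn]; exists n.+1 => /=.
case: ifP => // _; rewrite divr_gt0//.
have ys : y \in succ z.
  apply: contraLR qzy => ys; rewrite succ_rate ?ltxx//.
  by rewrite eq_sym.
rewrite (big_rem y)//= ltr_pwDl//; last first.
  by apply: sumr_ge0 => x _; rewrite mulr_ge0 ?jump_prob_ge0 ?discounted_hit_ge0.
by rewrite mulr_gt0// /jump_prob (negbTE zy) divr_gt0// exit_rate_gt0.
Qed.

Lemma discounted_hit_gt0_seq o (F : seq S) :
  (forall z, z \in F -> reachable q z o) ->
  exists n, forall z, z \in F -> 0 < discounted_hit o n z.
Proof.
elim: F => [|x F IH] h; first by exists 0%N.
have [|n hn] := IH; first by move=> z zF; apply: h; rewrite inE zF orbT.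
have [|m hm] := @discounted_hit_gt0 o x; first by apply: h; rewrite inE eqxx.
exists (maxn m n) => z; rewrite inE => /predU1P[->|/hn hz].
  exact: lt_le_trans hm (discounted_hit_homo _ _ (leq_maxl _ _)).
exact: lt_le_trans hz (discounted_hit_homo _ _ (leq_maxr _ _)).
Qed.

(** Per jump, [V] loses at least one in mean outside [F]. The corrected function [V - M * h] does so
    everywhere but at [o], as [taboo_sum_le] requires. *)
Lemma foster_positive_recurrent (V : S -> R) (F : seq S) (o : S) :
  (forall z, 0 <= V z) ->
  (forall z, z \notin F ->
    \sum_(y <- succ z) q z y * (V y - V z) <= - exit_rate q z) ->
  (forall z, z \in F -> reachable q z o) ->
  positive_recurrent q o.
Proof.
move=> V0 drift reach d T P X Y H XYH.
have [n hn] := discounted_hit_gt0_seq reach.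
pose h := discounted_hit o n.
pose D z := \sum_(y <- succ z) jump_prob q z y * V y - V z.
have D_le z : z \notin F -> D z <= - 1.
  move=> /drift hz; rewrite -(ler_pM2r (exit_rate_gt0 z)) mulN1r.
  have -> : D z = \sum_(y <- succ z) jump_prob q z y * (V y - V z).
    under [RHS]eq_bigr do rewrite mulrBr.
    by rewrite sumrB -mulr_suml sum_jump_prob1 mul1r.
  by rewrite sum_jump_prob divfK// gt_eqF// exit_rate_gt0.
(* For each [z] in [F], its own term already makes [M * h z] at least [D z + 1]. *)
pose M := \sum_(z <- F) (`|D z| + 1) / h z.
have M0 : 0 <= M.
  rewrite /M big_seq; apply: sumr_ge0 => z /hn hz.
  by rewrite divr_ge0 ?addr_ge0//; exact: ltW.
have MF z : z \in F -> D z <= M * h z - 1.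
  move=> zF; rewrite lerBrDr -ler_pdivrMr ?hn// /M (big_rem z)//= ler_wpDr//.
    rewrite big_seq; apply: sumr_ge0 => y /mem_rem /hn hy.
    by rewrite divr_ge0 ?addr_ge0//; exact: ltW.
  by rewrite ler_pM2r ?invr_gt0 ?hn// lerD2r ler_norm.
pose U z := V z - M * h z.
apply: (return_time_integrable XYH); apply: (taboo_sum_le (U := U) (B := M)) => [z|z zo].
  rewrite /U -addrA addr_ge0// addrC subr_ge0 ler_piMr//.
  exact: discounted_hit_le1.
(* Away from [o], [h] is at most its next iterate, which is half the mean of [h] after a jump. That
   mean thus exceeds [h z] by at least [h z], so the correction lowers the drift by at least
   [M * h z]. *)
have hz : h z * 2 <= \sum_(y <- succ z) jump_prob q z y * h y.
  rewrite -ler_pdivlMr//; apply: le_trans (discounted_hitS o n z) _.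
  by rewrite /= (negbTE zo).
have h0 : 0 <= h z by exact: discounted_hit_ge0.
rewrite /U; under eq_bigr do rewrite mulrBr mulrCA.
rewrite sumrB -mulr_sumr.
have : D z <= M * h z - 1.
  have [/MF//|/D_le Dz] := boolP (z \in F).
  by rewrite (le_trans Dz)// lerDr mulr_ge0.
have := ler_wpM2l M0 hz; rewrite /D mulrA; lra.
Qed.

End JumpChain.

(** * Phase-type services *)

Lemma cvg_sum_real (R : realType) (J : Type) (s : seq J) (f : J -> nat -> R)
    (l : J -> R) :
  (forall j, f j @ \oo --> l j) ->
  (fun n => \sum_(j <- s) f j n) @ \oo --> \sum_(j <- s) l j.
Proof. by move=> h; apply: cvg_big => [|j _]; [exact: add_continuous|exact: h]. Qed.

Lemma norm_eigenvalue_le_spectral_radius (R : realType) n (A : 'M[R]_n) (z : R[i]) :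
  eigenvalue (map_mx (real_complex R) A) z ->
  Normc.normc z <= spectral_radius A.
Proof.
move=> hz; apply: ub_le_sup; last by exists z.
set B := map_mx _ A.
have [r hr] := closed_field_poly_normal (char_poly B).
(* [sup] dominates only sets that are bounded above; the moduli of the roots of the characteristic
   polynomial sum to a bound. *)
exists (\sum_(y <- r) Normc.normc y) => _ [y /= hy <-].
have normc_ge0 (x : R[i]) : 0 <= Normc.normc x.
  by case: x => a b; exact: sqrtr_ge0.
have yr : y \in r.
  move: hy; rewrite eigenvalue_root_char hr rootZ ?root_prod_XsubC//.
  by rewrite (monicP (char_poly_monic _)) oner_eq0.
by rewrite (big_rem y)//= lerDl; apply: sumr_ge0 => x _.
Qed.

Lemma unitmx_sub1 (R : realType) n (A : 'M[R]_n) :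
  spectral_radius A < 1 -> 1%:M - A \in unitmx.
Proof.
move=> hA; rewrite -opprB -scaleN1r unitmxZ ?unitrN1//.
apply: contraT => nu; have : eigenvalue A 1.
  by rewrite /eigenvalue /eigenspace kermx_eq0 row_free_unit.
rewrite -(eigenvalue_map (real_complex R)) => /norm_eigenvalue_le_spectral_radius.
by rewrite rmorph1 Normc.normc1 leNgt hA.
Qed.

Section PhaseType.
Context (R : realType) (d : phase_type R).
Let n := nphases d.
Let P : 'M[R]_n := next_prob d.

Let pow_ge0 k i j : 0 <= (P ^+ k) i j.
Proof.
elim: k i j => [|k IH] i j; first by rewrite expr0 mxE; case: (i == j).
rewrite exprS -mulmxE mxE; apply: sumr_ge0 => l _.
by rewrite mulr_ge0// next_prob_ge0.
Qed.

(** Probability that a service now in phase [i] makes at least [k] further phase visits. *)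
Let tail k i : R := \sum_j (P ^+ k) i j.

Let tailS k i : tail k.+1 i = \sum_l P i l * tail k l.
Proof.
rewrite /tail exprS -mulmxE; under eq_bigr do rewrite mxE.
by rewrite exchange_big/=; apply: eq_bigr => l _; rewrite mulr_sumr.
Qed.

Let tail_ge0 k i : 0 <= tail k i.
Proof. by apply: sumr_ge0 => j _. Qed.

Let tail0 i : tail 0 i = 1.
Proof.
rewrite /tail expr0 (bigD1 i)//= mxE eqxx big1 ?addr0// => j ji.
by rewrite mxE eq_sym (negbTE ji).
Qed.

Let tail_nonincr i : {homo (tail ^~ i) : k l / (k <= l)%N >-> l <= k}.
Proof.
apply: (homo_leq (r := fun x y => y <= x)) => [//|x y z xy yz|k].
  exact: le_trans yz xy.
elim: k i => [|k IH] i.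
  rewrite tailS tail0; under eq_bigr do rewrite tail0 mulr1.
  exact: next_prob_sub.
rewrite tailS [leRHS]tailS; apply: ler_sum => l _.
by rewrite ler_wpM2l// next_prob_ge0.
Qed.

Let unit1P : 1%:M - P \in unitmx.
Proof. exact/unitmx_sub1/next_prob_radius. Qed.

(** The tails decrease, hence converge; by [tailS] the vector of limits is fixed by [P], and
    invertibility of [1%:M - P] makes it zero. *)
Let tail_cvg0 i : tail ^~ i @ \oo --> 0.
Proof.
have tail_cvg l : cvgn (tail ^~ l).
  apply: nonincreasing_is_cvgn; first exact: tail_nonincr.
  by exists 0 => _ [k _ <-].
pose v : 'cV[R]_n := \col_l limn (tail ^~ l).
have Pv : P *m v = v.
  apply/colP => l; rewrite !mxE; apply: esym; apply/cvg_lim => //.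
  rewrite -cvg_shiftS; under eq_fun do rewrite tailS.
  apply: cvg_sum_real => m; rewrite mxE; apply: cvgMl_tmp.
  exact: tail_cvg.
have v0 : v = 0.
  rewrite -[v]mul1mx -(mulVmx unit1P) -mulmxA mulmxBl mul1mx Pv subrr mulmx0.
  by [].
have <- : v i 0 = 0 by rewrite v0 mxE.
by rewrite mxE; exact: tail_cvg.
Qed.

Let pow_cvg0 i j : (fun k => (P ^+ k) i j) @ \oo --> 0.
Proof.
apply: (squeeze_cvgr _ (cvg_cst 0) (tail_cvg0 i)).
apply: nearW => k; rewrite pow_ge0/= /tail (bigD1 j)//= lerDl.
by apply: sumr_ge0 => l _.
Qed.

(** Mean numbers of visits to the phases: by [green_cvg], the sum of the powers of [P]. *)
Let green : 'M[R]_n := invmx (1%:M - P).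

Let green_cvg i j : series (fun k => (P ^+ k) i j) @ \oo --> green i j.
Proof.
have partial N : \sum_(k < N) P ^+ k = green - P ^+ N *m green.
  apply: (can_inj (mulmxK unit1P)).
  rewrite mulmxBl -mulmxA mulVmx// mulmx1.
  elim: N => [|N IH]; first by rewrite big_ord0 mul0mx expr0 subrr.
  rewrite big_ord_recr/= mulmxDl IH mulmxBr mulmx1 exprSr -mulmxE.
  by rewrite addrA subrK.
have -> : series (fun k => (P ^+ k) i j) =
    (fun N => green i j - \sum_l (P ^+ N) i l * green l j).
  apply/funext => N; rewrite /series/= big_mkord.
  transitivity ((\sum_(k < N) P ^+ k) i j); first by rewrite summxE.
  by rewrite partial !mxE.
rewrite -[X in _ --> X]subr0; apply: cvgB; first exact: cvg_cst.
have z : \sum_(l < n) 0 * green l j = 0 by rewrite big1// => l _; rewrite mul0r.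
rewrite -[X in _ --> X]z.
by apply: cvg_sum_real => l; apply: cvgMr_tmp; exact: pow_cvg0.
Qed.

Let green_ge0 i j : 0 <= green i j.
Proof.
have -> : green i j = limn (series (fun k => (P ^+ k) i j)).
  by apply/esym/cvg_lim => //; exact: green_cvg.
apply: limr_ge; first by apply/cvg_ex; exists (green i j); exact: green_cvg.
by apply: nearW => N; apply: sumr_ge0 => k _.
Qed.

(** Mean visits to each phase times the mean duration of a visit: the mean service still required
    when a visit to [i] begins. *)
Definition remaining_service (i : 'I_n) : R :=
  \sum_j green i j / service_rate j.

Lemma mean_serviceE :
  mean_service d = \sum_j start_prob j * remaining_service j.
Proof.
rewrite /mean_service exchange_big/=; apply: eq_bigr => j _.
rewrite mulr_sumr; apply: eq_bigr => i _; rewrite mulrA.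
apply/cvg_lim => //.
have -> : series (fun k => start_prob j * (next_prob d ^+ k) j i / service_rate i) =
    (fun N => start_prob j * series (fun k => (P ^+ k) j i) N / service_rate i).
  by apply/funext => N; rewrite /series/= mulr_sumr mulr_suml.
by apply: cvgMr_tmp; apply: cvgMl_tmp; exact: green_cvg.
Qed.

(** First-step equation, from [green = 1%:M + P *m green]. *)
Lemma remaining_serviceE i : remaining_service i =
  (service_rate i)^-1 + \sum_j next_prob d i j * remaining_service j.
Proof.
have greenE j : green i j = (i == j)%:R + \sum_l P i l * green l j.
  have : (1%:M - P) *m green = 1%:M by rewrite mulmxV.
  rewrite mulmxBl mul1mx => /matrixP/(_ i j).
  by rewrite !mxE => <-; rewrite subrK.
rewrite {1}/remaining_service; under eq_bigr do rewrite greenE mulrDl.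
rewrite big_split/= (bigD1 i)//= eqxx mul1r big1 ?addr0; last first.
  by move=> j ji; rewrite eq_sym (negbTE ji) mul0r.
congr (_ + _); under eq_bigr do rewrite mulr_suml.
rewrite exchange_big/=; apply: eq_bigr => l _.
by rewrite mulr_sumr; apply: eq_bigr => j _; rewrite mulrA.
Qed.

Lemma remaining_service_gt0 i : 0 < remaining_service i.
Proof.
rewrite remaining_serviceE ltr_pwDl ?invr_gt0 ?service_rate_gt0//.
apply: sumr_ge0 => j _; rewrite mulr_ge0 ?next_prob_ge0//.
apply: sumr_ge0 => l _; rewrite divr_ge0//.
exact/ltW/service_rate_gt0.
Qed.

(** Rate of visits to phase [j] when services begin in phase [i] at rate [a i]. *)
Definition throughput (a : 'I_n -> R) (j : 'I_n) : R := \sum_i a i * green i j.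

(** Traffic equations, from [green = 1%:M + green *m P]. *)
Lemma throughputE a j :
  throughput a j = a j + \sum_i throughput a i * next_prob d i j.
Proof.
have greenE i : green i j = (i == j)%:R + \sum_l green i l * P l j.
  have : green *m (1%:M - P) = 1%:M by rewrite mulVmx.
  rewrite mulmxBr mulmx1 => /matrixP/(_ i j).
  by rewrite !mxE => <-; rewrite subrK.
rewrite {1}/throughput; under eq_bigr do rewrite greenE mulrDr.
rewrite big_split/= (bigD1 j)//= eqxx mulr1 big1 ?addr0; last first.
  by move=> i ij; rewrite (negbTE ij) mulr0.
congr (_ + _); under eq_bigr do rewrite mulr_sumr.
rewrite exchange_big/=; apply: eq_bigr => l _.
by rewrite mulr_suml; apply: eq_bigr => i _; rewrite mulrA.
Qed.

Lemma throughput_ge a : (forall i, 0 <= a i) -> forall j, a j <= throughput a j.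
Proof.
move=> a0 j; rewrite throughputE lerDl; apply: sumr_ge0 => i _.
rewrite mulr_ge0 ?next_prob_ge0//; apply: sumr_ge0 => l _.
by rewrite mulr_ge0.
Qed.

Lemma sum_throughput a :
  \sum_j throughput a j / service_rate j = \sum_i a i * remaining_service i.
Proof.
under eq_bigr do rewrite mulr_suml.
rewrite exchange_big/=; apply: eq_bigr => i _.
by rewrite mulr_sumr; apply: eq_bigr => j _; rewrite mulrA.
Qed.

End PhaseType.

(** * Proportional fairness *)

Lemma cvg_ptws (R : realType) (U : choiceType) (F : set_system {ptws U -> R})
    (f : {ptws U -> R}) : Filter F ->
  (forall u, (fun g => g u) @ F --> f u) -> F --> f.
Proof.
move=> FF h; apply/cvg_sup => u.
rewrite cvg_image; last first.
  by rewrite eqEsubset; split=> v // _; exists (fun=> v).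
move=> W Wf; exists (@^~ u @^-1` W); first exact: h.
rewrite eqEsubset; split => [v [g + <-]//|v Wv].
by exists (fun=> v).
Qed.

Lemma continuous_ptws (R : realType) (T : topologicalType) (U : choiceType)
    (g : T -> {ptws U -> R}) :
  (forall u, continuous (fun t => g t u)) -> continuous g.
Proof. by move=> h t; apply: cvg_ptws => u; exact: h. Qed.

Lemma continuous_eval (R : realType) (U : choiceType) (u : U) :
  continuous (fun l : {ptws U -> R} => l u).
Proof. exact: (@proj_continuous U (fun=> R) u). Qed.

Lemma continuous_sum (R : realType) (T : topologicalType) (J : Type)
    (s : seq J) (f : J -> T -> R) :
  (forall j, continuous (f j)) -> continuous (fun t => \sum_(j <- s) f j t).
Proof.
move=> h; elim: s => [|j s IH] t.
  have -> : (fun t => \sum_(j <- [::]) f j t) = (fun=> 0).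
    by apply/funext => u; rewrite big_nil.
  exact: cvg_cst.
have -> : (fun t => \sum_(i <- j :: s) f i t) =
    (fun t => f j t + \sum_(i <- s) f i t).
  by apply/funext => u; rewrite big_cons.
by apply: cvgD; [exact: h|exact: IH].
Qed.

Lemma sum_user_phase (R : realType) (I : finType) (svc : I -> phase_type R)
    (F : user_phase svc -> R) :
  \sum_s F s = \sum_r \sum_(i < nphases (svc r)) F (at_phase i).
Proof.
rewrite sig_big_dep/=; apply: eq_bigr => -[r i] _.
by [].
Qed.

Lemma ln_ge1BV (R : realType) (y : R) : 0 < y -> 1 - y^-1 <= ln y.
Proof.
move=> y0; have h : -1 < y^-1 - 1 by rewrite ltrBrDl subrr invr_gt0.
have := le_ln1Dx h; rewrite addrCA subrr addr0 lnV ?posrE//.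
by lra.
Qed.

(** * Existence, optimality and equal sharing of the proportionally fair allocation *)

Section CapacitySet.
Context (R : realType) (I : finType) (C : set {ptws I -> R}).
Hypothesis hC : capacity_set C.

Lemma capacity_conv (l k : I -> R) (t : R) : C l -> C k -> 0 <= t <= 1 ->
  C (fun r => t * k r + (1 - t) * l r).
Proof.
move=> hl hk /andP[t0 t1].
have := capacity_convex hC (Itv01 t0 t1) (mem_set hk) (mem_set hl).
by move/set_mem.
Qed.

Lemma capacity_bounded : exists2 B, 0 <= B & forall l, C l -> forall r, l r <= B.
Proof.
have [l0 hl0 l0_gt0] := capacity_pos hC.
have [|||c /set_mem cC cmax] := @compact_EVT_max _ R
    (fun l : {ptws I -> R} => \sum_r l r) C.
- by exists l0.
- exact: capacity_compact hC.
- apply: continuous_subspaceT; apply: continuous_sum => r.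
  exact: continuous_eval.
exists (\sum_r c r); first by apply: sumr_ge0 => r _; exact: (capacity_ge0 hC).
move=> l hl r; apply: le_trans (cmax l (mem_set hl)).
rewrite (bigD1 r)//= lerDl; apply: sumr_ge0 => r' _.
exact: (capacity_ge0 hC).
Qed.

Lemma capacity_closed : closed C.
Proof.
apply: compact_closed (capacity_compact hC).
by apply: (@hausdorff_product I (fun=> R)) => _; exact: norm_hausdorff.
Qed.

Context (svc : I -> phase_type R).
Notation up := (user_phase svc).

Let type_sum (l : up -> R) : {ptws I -> R} :=
  fun r => \sum_(i < nphases (svc r)) l (at_phase i).

Lemma phase_capacity_down (l l' : up -> R) :
  (forall s, 0 <= l s) -> (forall s, l s <= l' s) ->
  phase_capacity C l' -> phase_capacity C l.
Proof.
move=> l0 ll' [_ hl']; split => //.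
apply: (capacity_down hC) hl' => r; first by apply: sumr_ge0.
by apply: ler_sum.
Qed.

Lemma phase_capacity_pos : exists2 l, phase_capacity C l & forall s : up, 0 < l s.
Proof.
have [l0 hl0 l0_gt0] := capacity_pos hC.
have n_gt0 (s : up) : (0 < nphases (svc (tag s)))%N.
  by case: s => r [i /= h]; exact: leq_ltn_trans h.
have l_gt0 (s : up) : 0 < l0 (tag s) / (nphases (svc (tag s)))%:R.
  by rewrite divr_gt0// ltr0n.
exists (fun s => l0 (tag s) / (nphases (svc (tag s)))%:R) => //.
split => [s|]; first exact: ltW.
apply: (capacity_down hC) hl0 => r.
  by apply: sumr_ge0 => i _; apply: (ltW (l_gt0 (at_phase i))).
rewrite (eq_bigr (fun=> l0 r / (nphases (svc r))%:R))//.
rewrite sumr_const card_ord -[_ *+ _]mulr_natr.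
have [->|n0] := posnP (nphases (svc r)); first by rewrite mulr0 ltW.
by rewrite divfK// pnatr_eq0 -lt0n.
Qed.

Lemma phase_capacity_bounded : exists2 B, 0 <= B &
  forall l, phase_capacity C l -> forall s : up, 0 <= l s <= B.
Proof.
have [B B0 hB] := capacity_bounded; exists B => // l [l0 hl] [r i].
rewrite l0/=; apply: le_trans (hB _ hl r).
by rewrite (bigD1 i)//= lerDl; apply: sumr_ge0.
Qed.

Lemma phase_capacity_compact : compact (phase_capacity C : set {ptws up -> R}).
Proof.
have [B B0 hB] := phase_capacity_bounded.
have -> : phase_capacity C =
    [set l : {ptws up -> R} | forall s, `[0, B]%classic (l s)] `&` type_sum @^-1` C.
  apply/seteqP; split => l.
    by move=> hl; split; [move=> s /=; rewrite in_itv/= hB|case: hl].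
  move=> [h hl]; split => // s; have := h s.
  by rewrite /= in_itv/= => /andP[].
apply: compact_closedI.
  apply: (@tychonoff up (fun=> R) (fun=> `[0, B]%classic)) => _.
  exact: segment_compact.
apply: closed_comp capacity_closed => l _.
apply: continuous_ptws => r {}l.
by apply: continuous_sum => i; exact: continuous_eval.
Qed.

Lemma phase_capacity_conv (l k : up -> R) (t : R) :
  phase_capacity C l -> phase_capacity C k -> 0 <= t <= 1 ->
  phase_capacity C (fun s => t * k s + (1 - t) * l s).
Proof.
move=> [l0 hl] [k0 hk] /andP[t0 t1]; split.
  by move=> s; rewrite addr_ge0// mulr_ge0// subr_ge0.
have := capacity_conv hl hk (introT andP (conj t0 t1)).
by congr C; apply/funext => r; rewrite big_split/= !mulr_sumr.
Qed.

(** Exponential of the objective where the latter is finite. Being a polynomial, it is continuous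
    also where coordinates vanish, so compactness yields a maximizer. *)
Let weight (x : state svc) (l : up -> R) : R := \prod_s l s ^+ x s.

Let objectiveE (x : state svc) (l : up -> R) :
  (forall s, (0 < x s)%N -> 0 < l s) ->
  pf_objective x l = (\sum_s (x s)%:R * ln (l s))%:E.
Proof.
move=> h; rewrite /pf_objective -sumEFin; apply: eq_bigr => s _.
have [->|xs] := posnP (x s); first by rewrite mul0e mul0r.
by rewrite lne_EFin ?h// EFinM.
Qed.

Let objective_Ny (x : state svc) (l : up -> R) s :
  (0 < x s)%N -> l s <= 0 -> pf_objective x l = -oo%E.
Proof.
move=> xs ls; apply/eqP; rewrite esum_eqNy; apply/existsP; exists s.
by rewrite /= -/(lne (l s)%:E) le0_lneNy ?lee_fin// gt0_muleNy// lte_fin ltr0n.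
Qed.

Let weightE (x : state svc) (l : up -> R) :
  (forall s, (0 < x s)%N -> 0 < l s) ->
  weight x l = expR (\sum_s (x s)%:R * ln (l s)).
Proof.
move=> h; rewrite expR_sum; apply: eq_bigr => s _.
have [->|xs] := posnP (x s); first by rewrite expr0 mul0r expR0.
by rewrite expRM_natl lnK// posrE h.
Qed.

Let weight_gt0 (x : state svc) (l : up -> R) : (forall s, 0 <= l s) ->
  0 < weight x l -> forall s, (0 < x s)%N -> 0 < l s.
Proof.
move=> l0 w s xs; rewrite lt_neqAle l0 andbT; apply: contraTneq w => ls.
rewrite /weight (bigD1 s)//= -ls expr0n eqn0Ngt xs mul0r.
by rewrite ltxx.
Qed.

Lemma is_pf_exists (x : state svc) : exists l, is_pf C x l.
Proof.
have [p hp p0] := phase_capacity_pos.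
have [|||c /set_mem hc cmax] := @compact_EVT_max _ R
    (weight x : {ptws up -> R} -> R) (phase_capacity C).
- by exists p.
- exact: phase_capacity_compact.
- apply: continuous_subspaceT; rewrite /weight => l.
  have cont (T : topologicalType) (f : up -> T -> R) (s : seq up) :
      (forall u, continuous (f u)) -> continuous (fun t => \prod_(u <- s) f u t).
    move=> h; elim: s => [|u s IH] t.
      have -> : (fun t => \prod_(u <- [::]) f u t) = (fun=> 1).
        by apply/funext => v; rewrite big_nil.
      exact: cvg_cst.
    have -> : (fun t => \prod_(i <- u :: s) f i t) =
        (fun t => f u t * \prod_(i <- s) f i t).
      by apply/funext => v; rewrite big_cons.
    by apply: cvgM; [exact: h|exact: IH].
  apply: (cont _ (fun s (l : {ptws up -> R}) => l s ^+ x s)) => s {}l.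
  apply: (@continuous_comp _ _ _ (fun l : {ptws up -> R} => l s) (fun y => y ^+ x s)).
    exact: continuous_eval.
  exact: exprn_continuous.
(* Coordinates without users have exponent zero: setting them to zero, as [is_pf] demands, preserves
   the weight and stays in the set by monotonicity. *)
have c0 := hc.1; pose l s := if x s == 0%N then 0 else c s.
have l0 s : 0 <= l s by rewrite /l; case: ifP.
have wl : weight x l = weight x c.
  apply: eq_bigr => s _; rewrite /l; case: eqP => // ->.
  by rewrite !expr0.
have wc : 0 < weight x c.
  apply: lt_le_trans (cmax p (mem_set hp)).
  by apply: prodr_gt0 => s _; rewrite exprn_gt0.
have lpos := weight_gt0 l0 (eq_ind_r (fun w => 0 < w) wc wl).
exists l; split.
- apply: phase_capacity_down hc => // s; rewrite /l; case: ifP => // _.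
- by move=> s xs; rewrite /l xs eqxx.
move=> k hk; have k0 := hk.1.
have [kpos|] := pselect (forall s, (0 < x s)%N -> 0 < k s).
  rewrite !objectiveE// lee_fin -ler_expR -!weightE// wl.
  exact: cmax (mem_set hk).
move=> /existsNP[s /not_implyP[xs /negP]]; rewrite -leNgt => ks.
by rewrite (objective_Ny xs ks) leNye.
Qed.

Context (x : state svc).
Let l := pf C x.

Let is_pf_pf : is_pf C x l.
Proof. by have [k hk] := is_pf_exists x; exact: (xgetPex (fun=> 0)) (ex_intro _ k hk). Qed.

Lemma phase_capacity_pf : phase_capacity C l.
Proof. by case: is_pf_pf. Qed.

Lemma pf_ge0 s : 0 <= l s.
Proof. by case: phase_capacity_pf. Qed.

Lemma pf_eq0 s : x s = 0%N -> l s = 0.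
Proof. by case: is_pf_pf => _ + _; exact. Qed.

(** Otherwise the objective at the maximizer would be [-oo], below its finite value at a strictly
    positive vector. *)
Lemma pf_gt0 s : (0 < x s)%N -> 0 < l s.
Proof.
move=> xs; rewrite ltNge; apply/negP => ls.
have [p hp p0] := phase_capacity_pos.
case: is_pf_pf => _ _ /(_ p hp).
rewrite (objective_Ny xs ls) objectiveE; last by move=> u _; exact: p0.
by [].
Qed.

(* First-order optimality: the derivative of the objective at [l] in the
   direction [k - l] is nonpositive. *)
Lemma pf_variational (k : up -> R) : phase_capacity C k ->
  \sum_s (x s)%:R * (k s / l s) <= \sum_s (x s)%:R.
Proof.
move=> hk; have k0 := hk.1.
pose u s := k s / l s - 1.
pose A := \sum_s (x s)%:R * u s; pose B := \sum_s (x s)%:R * u s ^+ 2.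
suff : A <= 0.
  rewrite /A /u; under eq_bigr do rewrite mulrBr mulr1.
  by rewrite sumrB subr_le0.
have B0 : 0 <= B by apply: sumr_ge0 => s _; rewrite mulr_ge0// sqr_ge0.
(* Compare [l] with a point [m] of the segment towards [k]. As [u s >= -1] and [t <= 1 / 2], one has
   [1 + t * u s >= 1 / 2], whence [ln (1 + t * u s) >= t * u s - 2 * t ^+ 2 * u s ^+ 2]; optimality
   of [l] concludes. *)
have key t : 0 < t -> t <= 1 / 2 -> A <= 2 * t * B.
  move=> t0 t2; pose m s := t * k s + (1 - t) * l s.
  have t1 : t < 1 by lra.
  have hm : phase_capacity C m.
    by apply: phase_capacity_conv phase_capacity_pf hk _; rewrite !ltW.
  have m0 s : (0 < x s)%N -> 0 < m s.
    move=> xs; rewrite /m ltr_wpDl ?mulr_gt0 ?pf_gt0 ?subr_gt0//.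
    by rewrite mulr_ge0// ltW.
  case: is_pf_pf => _ _ /(_ m hm).
  rewrite !objectiveE//; last exact: pf_gt0.
  rewrite lee_fin -subr_le0 -sumrB => hle.
  have : \sum_s (x s)%:R * (t * u s - 2 * t ^+ 2 * u s ^+ 2) <= 0.
    apply: le_trans hle; apply: ler_sum => s _; rewrite -mulrBr.
    have [->|xs] := posnP (x s); first by rewrite !mul0r.
    apply: ler_wpM2l => //; have ls := pf_gt0 xs.
    have us : -1 <= u s by rewrite /u lerBrDr addNr divr_ge0// ltW.
    have y0 : 0 < 1 + t * u s by nra.
    have -> : ln (m s) - ln (l s) = ln (1 + t * u s).
      rewrite -ln_div ?posrE ?m0//; congr ln.
      by rewrite /m /u; field; rewrite gt_eqF.
    apply: le_trans (ln_ge1BV y0).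
    rewrite -(ler_pM2r y0).
    have -> : (1 - (1 + t * u s)^-1) * (1 + t * u s) = t * u s.
      by rewrite mulrBl mul1r mulVf ?gt_eqF// addrAC subrr add0r.
    have hy : 1 / 2 <= 1 + t * u s by nra.
    have uu : 0 <= u s ^+ 2 := sqr_ge0 _.
    have tt : 0 <= t ^+ 2 := sqr_ge0 _.
    have := mulr_ge0 (mulr_ge0 tt uu) (_ : 0 <= 1 + t * u s - 1 / 2).
    rewrite subr_ge0 => /(_ hy).
    by rewrite !expr2; nra.
  have -> : \sum_s (x s)%:R * (t * u s - 2 * t ^+ 2 * u s ^+ 2) =
      t * (A - 2 * t * B).
    rewrite /A /B mulrBr !mulr_sumr -sumrB; apply: eq_bigr => s _; ring.
  by rewrite pmulr_rle0// subr_le0.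
rewrite leNgt; apply/negP => A0.
(* With [A] positive, this [t] gives [2 * t * B < A], against [key]. *)
pose t := Num.min (1 / 2) (A / (4 * (B + 1))).
have t0 : 0 < t.
  by rewrite /t lt_min !divr_gt0// ?mulr_gt0// ltr_wpDl.
have t2 : t <= 1 / 2 by rewrite /t ge_min lexx.
have tA : t * (4 * (B + 1)) <= A.
  by rewrite -ler_pdivlMr ?mulr_gt0 ?ltr_wpDl// /t ge_min lexx orbT.
by have := key t t0 t2; nra.
Qed.

Lemma sum_at_phase_eq r (s : up) :
  \sum_(i < nphases (svc r)) (at_phase i == s)%:R = (r == tag s)%:R :> R.
Proof.
case: s => r' j /=; have [rr|rr] := eqVneq r r'; last first.
  rewrite big1// => i _; case: eqP => // /(congr1 tag)/= rr'.
  by move: rr; rewrite rr' eqxx.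
subst r'; rewrite (bigD1 j)//= eqxx big1 ?addr0// => i ij.
by rewrite /at_phase eq_Tagged/= (negbTE ij).
Qed.

(* The bandwidth of a type is shared equally among its users: otherwise moving
   all of it from phase [s] to phase [s'] would contradict optimality. *)
Lemma pf_proportional (s s' : up) : tag s = tag s' ->
  l s * (x s')%:R = l s' * (x s)%:R.
Proof.
suff le u v : tag u = tag v -> l u * (x v)%:R <= l v * (x u)%:R.
  by move=> ss; apply/eqP; rewrite eq_le !le.
move=> uv; have [xu|xu] := posnP (x u); first by rewrite pf_eq0// xu mul0r mulr0.
have [xv|xv] := posnP (x v); first by rewrite xv mulr0 pf_eq0// mul0r.
have [->//|neq] := eqVneq u v.
have lu := pf_gt0 xu; have lv := pf_gt0 xv.
pose k w := l w + ((w == v)%:R - (w == u)%:R) * l u.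
have hk : phase_capacity C k.
  have [l0 hl] := phase_capacity_pf; split.
    move=> w; rewrite /k; have [->|wu] := eqVneq w u.
      by rewrite (negbTE neq) sub0r mulN1r subrr.
    by rewrite subr0 addr_ge0// mulr_ge0.
  move: hl; congr C; apply/funext => r; rewrite /k big_split/= -mulr_suml.
  by rewrite sumrB !sum_at_phase_eq uv subrr mul0r addr0.
(* Only the terms of [u] and [v] change: the first vanishes and the second grows by
   [x v * l u / l v], which is therefore at most [x u]. *)
have := pf_variational hk.
rewrite -subr_ge0 -sumrB (bigD1 u)//= (bigD1 v) 1?eq_sym//= big1 ?addr0.
  rewrite /k eqxx (negbTE neq) eqxx eq_sym (negbTE neq) sub0r mulN1r subrr.
  rewrite mul0r mulr0 !subr0 mul1r => h.
  have : (x v)%:R - (x v)%:R * ((l v + l u) / l v) = - (x v)%:R * l u / l v.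
    by field; rewrite gt_eqF.
  move=> e; move: h; rewrite e mulNr mulNr subr_ge0 ler_pdivrMr//.
  by rewrite mulrC [in X in _ -> X]mulrC; rewrite mulrC [l v * _]mulrC.
move=> w /andP[wu wv]; rewrite /k (negbTE wu) (negbTE wv) subrr mul0r addr0.
have [->|xw] := posnP (x w); first by rewrite mul0r subr0.
by rewrite divff ?mulr1 ?subrr// gt_eqF// pf_gt0.
Qed.

Lemma pf_type_share (s : up) :
  l s * \sum_(i < nphases (svc (tag s))) (x (at_phase i))%:R =
  (x s)%:R * \sum_(i < nphases (svc (tag s))) l (at_phase i).
Proof.
rewrite !mulr_sumr; apply: eq_bigr => i _.
by rewrite (@pf_proportional s (at_phase i))// mulrC.
Qed.

End CapacitySet.

(** * Drift of the energy *)

Section TypeDrift.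
Context (R : realType) (d : phase_type R).
Let n := nphases d.
Let m := @remaining_service R d.
Let mu := @service_rate R d.
Context (a b : 'I_n -> R).
Hypothesis a_le : forall i, 0 <= a i <= b i.
Hypothesis b_gt0 : forall i, 0 < b i.

Definition phase_load (i : 'I_n) : R := throughput b i / mu i.

Lemma phase_load_gt0 i : 0 < phase_load i.
Proof.
rewrite divr_gt0 ?service_rate_gt0// (lt_le_trans (b_gt0 i))//.
by apply: throughput_ge => j; exact: ltW.
Qed.

(** The left-hand side is the first-order drift of the energy due to one type, with arrival rates
    [a] raised to [b] in the loads; [theta] is the bandwidth per user. *)
Lemma type_drift_le (theta : R) (x l : 'I_n -> R) : 0 < theta ->
  (forall i, 0 <= x i) -> (forall i, l i = theta * x i) ->
  \sum_i (a i * (m i / phase_load i * x i)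
    + \sum_j mu i * l i * next_prob d i j * (m j / phase_load j * x j)
    - mu i * l i * (m i / phase_load i * x i))
  <= (\sum_i phase_load i) / theta - \sum_i x i.
Proof.
move=> theta0 x0 lE; pose La := throughput b; pose rho := phase_load.
have rho0 i : 0 < rho i by exact: phase_load_gt0.
have mu0 i : 0 < mu i by exact: service_rate_gt0.
have m0 i : 0 < m i by exact: remaining_service_gt0.
have La0 i : 0 < La i by rewrite -(pmulr_lgt0 _ (_ : 0 < (mu i)^-1)) ?invr_gt0//; exact: rho0.
(* [u i] is the ratio of bandwidth to load in phase [i]. Multiplying by [theta] turns the claim into
   a quadratic inequality in [u]. *)
have [u uE] : exists u : 'I_n -> R, forall i, u i = theta * x i / rho i.
  by exists (fun i => theta * x i / rho i).
have xE i : x i = rho i * u i / theta by rewrite uE; field; rewrite !gt_eqF.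
have muE i : mu i * rho i = La i by rewrite /rho /phase_load mulrC divfK// gt_eqF.
rewrite -(ler_pM2r theta0) mulrBl divfK ?gt_eqF//.
have -> : (\sum_i x i) * theta = \sum_i rho i * u i.
  by rewrite mulr_suml; apply: eq_bigr => i _; rewrite {1}xE divfK// gt_eqF.
rewrite mulr_suml.
have termE i : (a i * (m i / phase_load i * x i)
    + \sum_j mu i * l i * next_prob d i j * (m j / phase_load j * x j)
    - mu i * l i * (m i / phase_load i * x i)) * theta =
    a i * m i * u i + \sum_j La i * next_prob d i j * m j * (u i * u j)
      - La i * m i * u i ^+ 2.
  have xe j : m j / phase_load j * x j = m j * u j / theta.
    by rewrite [in LHS]xE -/(rho j); field; rewrite !gt_eqF.
  have le : mu i * l i = La i * u i.
    by rewrite lE [in LHS]xE -muE; field; rewrite gt_eqF.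
  rewrite xe le mulrBl mulrDl; congr (_ + _ - _).
  - by field; rewrite gt_eqF.
  - rewrite mulr_suml; apply: eq_bigr => j _; rewrite xe.
    by field; rewrite gt_eqF.
  - by field; rewrite gt_eqF.
under eq_bigr do rewrite termE.
pose S i := \sum_j next_prob d i j * m j.
have SE i : S i = m i - (mu i)^-1.
  by rewrite /S /m [in RHS]remaining_serviceE addrAC subrr add0r.
pose W j := \sum_i La i * next_prob d i j.
have WE j : W j = La j - b j by rewrite /W /La [in RHS]throughputE addrAC subrr add0r.
(* Only squares are left on the right, by [2 * u i <= 1 + u i ^+ 2] and
   [2 * u i * u j <= u i ^+ 2 + u j ^+ 2]. *)
have bound i : a i * m i * u i + \sum_j La i * next_prob d i j * m j * (u i * u j)
      - La i * m i * u i ^+ 2 <=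
    b i * m i * (1 + u i ^+ 2) / 2 + La i * S i * u i ^+ 2 / 2
      + (\sum_j La i * next_prob d i j * (m j * u j ^+ 2)) / 2 - La i * m i * u i ^+ 2.
  rewrite lerD2r -addrA lerD//.
    have /andP[a0 ab] := a_le i.
    have u2 : u i * 2 <= 1 + u i ^+ 2.
      by have := sqr_ge0 (u i - 1); rewrite !expr2; nra.
    rewrite ler_pdivlMr// -!mulrA; apply: (@le_trans _ _ (b i * (m i * (u i * 2)))).
      apply: ler_wpM2r => //; apply: mulr_ge0; first exact: ltW.
      apply: mulr_ge0 => //; rewrite uE; apply: divr_ge0; last exact: ltW.
      by apply: mulr_ge0 => //; exact: ltW.
    by rewrite !ler_pM2l.
  rewrite -mulrDl ler_pdivlMr// mulr_suml /S mulr_sumr mulr_suml -big_split/=.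
  apply: ler_sum => j _.
  have p0 := next_prob_ge0 i j.
  have := sqr_ge0 (u i - u j).
  have w0 : 0 <= La i * next_prob d i j * m j.
    by apply: mulr_ge0; [apply: mulr_ge0 => //|]; exact: ltW.
  move=> /(mulr_ge0 w0); rewrite !expr2; nra.
apply: le_trans (ler_sum _ (fun i _ => bound i)) _.
rewrite !sumrB !big_split/=.
have -> : \sum_i (\sum_j La i * next_prob d i j * (m j * u j ^+ 2)) / 2 =
    \sum_j (La j - b j) * (m j * u j ^+ 2) / 2.
  rewrite -!mulr_suml exchange_big/=; congr (_ / _); apply: eq_bigr => j _.
  by rewrite -WE /W mulr_suml.
have loadE : \sum_i rho i = \sum_i b i * m i by exact: sum_throughput.
rewrite -!big_split/= -!sumrB.
(* By [SE] and [WE], the coefficient of [u i ^+ 2] collapses to [- La i / (2 * mu i)], that is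
   [- rho i / 2]. *)
apply: (@le_trans _ _ (\sum_i (b i * m i / 2 - rho i * u i ^+ 2 / 2))).
  rewrite le_eqVlt; apply/orP; left; apply/eqP; apply: eq_bigr => i _.
  rewrite SE /rho /phase_load -/La; field; rewrite gt_eqF//.
(* As [\sum_i b i * m i] is the total load, the claim reduces phase by phase to
   [0 <= rho i * (u i - 1) ^+ 2]. *)
have halfE : \sum_i b i * m i / 2 = \sum_i rho i / 2 by rewrite -!mulr_suml loadE.
rewrite [leLHS]sumrB halfE -!sumrB; apply: ler_sum => i _.
have := mulr_ge0 (ltW (rho0 i)) (sqr_ge0 (u i - 1)); rewrite -/rho !expr2; nra.
Qed.

End TypeDrift.

(** * Transitions of the process of user numbers *)

Section UserNumbers.
Context (R : realType) (I : finType) (C : set {ptws I -> R}).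
Hypothesis hC : capacity_set C.
Context (nu : I -> R) (svc : I -> phase_type R).
Hypothesis nu_gt0 : forall r, 0 < nu r.
Notation up := (user_phase svc).
Notation st := (state svc).
Notation q := (@pf_rate R I svc C nu).
Implicit Types (x y z : st) (s : up).

Definition remove_user x s : st := [ffun s' => (x s' - (s' == s))%N].

(** The list may contain states of zero rate; that it misses none of positive rate is
    [pf_rate_out]. *)
Definition successors x : seq st :=
  [seq y <- undup ([seq x + unit_state s | s <- enum up]
    ++ [seq remove_user x s + unit_state s' | s <- enum up, s' <- enum up]
    ++ [seq remove_user x s | s <- enum up]) | y != x].

Lemma successors_uniq x : uniq (successors x).
Proof. by rewrite filter_uniq// undup_uniq. Qed.

Lemma successors_irr x : x \notin successors x.
Proof. by rewrite mem_filter eqxx. Qed.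

Lemma add_stateE x y s : (x + y) s = (x s + y s)%N.
Proof. by rewrite ffunE. Qed.

Lemma unit_stateE s s' : unit_state s s' = (s' == s) :> nat.
Proof. by rewrite ffunE. Qed.

Lemma remove_userE x s s' : remove_user x s s' = (x s' - (s' == s))%N.
Proof. by rewrite ffunE. Qed.

Lemma add_unit_eq y x s : (0 < x s)%N ->
  (y + unit_state s == x) = (y == remove_user x s).
Proof.
move=> xs; apply/eqP/eqP => [<-|->]; apply/ffunP => s'.
  by rewrite remove_userE add_stateE unit_stateE addnK.
rewrite add_stateE remove_userE unit_stateE subnK//.
by case: eqP => // ->.
Qed.

Lemma add_unit_eq_add y x s s' : (0 < x s)%N ->
  (y + unit_state s == x + unit_state s') = (y == remove_user x s + unit_state s').
Proof.
move=> xs; rewrite add_unit_eq; last by rewrite add_stateE addn_gt0 xs.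
congr (y == _); apply/ffunP => u.
rewrite add_stateE !remove_userE !add_stateE addnBAC//.
by case: eqP => // ->.
Qed.

(** Applied to [G := fun y => V y - V x], this is the generator at [V]. *)
Definition generator x (G : st -> R) : R :=
  \sum_r \sum_(i < nphases (svc r)) (
      nu r * start_prob i * G (x + unit_state (at_phase i))
    + \sum_(j < nphases (svc r))
        service_rate i * pf C x (at_phase i) * next_prob (svc r) i j
          * G (remove_user x (at_phase i) + unit_state (at_phase j))
    + service_rate i * pf C x (at_phase i)
        * (1 - \sum_(j < nphases (svc r)) next_prob (svc r) i j)
        * G (remove_user x (at_phase i))).

Lemma sum_successors_eq x z (G : st -> R) : G x = 0 ->
  (z == x) || (z \in successors x) ->
  \sum_(y <- successors x) (y == z)%:R * G y = G z.
Proof.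
move=> Gx; have [-> _|zx /= zs] := eqVneq z x.
  rewrite Gx big_seq big1// => y; rewrite mem_filter => /andP[yx _].
  by rewrite (negbTE yx) mul0r.
rewrite (bigD1_seq z) ?successors_uniq//= eqxx mul1r big1 ?addr0// => y yz.
by rewrite (negbTE yz) mul0r.
Qed.

Lemma mem_successors_add x s :
  (x + unit_state s == x) || (x + unit_state s \in successors x).
Proof.
rewrite mem_filter; case: eqP => //= _.
rewrite mem_undup mem_cat; apply/orP; left.
by apply/mapP; exists s; rewrite ?mem_enum.
Qed.

Lemma mem_successors_move x s s' :
  (remove_user x s + unit_state s' == x) ||
  (remove_user x s + unit_state s' \in successors x).
Proof.
rewrite mem_filter; case: eqP => //= _.
rewrite mem_undup !mem_cat; apply/orP; right; apply/orP; left.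
by apply/allpairsP; exists (s, s'); rewrite !mem_enum.
Qed.

Lemma mem_successors_remove x s :
  (remove_user x s == x) || (remove_user x s \in successors x).
Proof.
rewrite mem_filter; case: eqP => //= _.
rewrite mem_undup !mem_cat; apply/orP; right; apply/orP; right.
by apply/mapP; exists s; rewrite ?mem_enum.
Qed.

(** With a user in the phase, each indicator singles out one target. In an empty phase the bandwidth
    is zero, which removes the terms where truncated subtraction would be wrong. Transitions back to
    [x] count for nothing since [G x = 0]. *)
Lemma sum_successors x (G : st -> R) : G x = 0 ->
  \sum_(y <- successors x) q x y * G y = generator x G.
Proof.
move=> Gx.
rewrite /pf_rate; under eq_bigr do rewrite mulr_suml.
rewrite exchange_big/=; apply: eq_bigr => r _.
under eq_bigr do rewrite mulr_suml.
rewrite exchange_big/=; apply: eq_bigr => i _.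
under eq_bigr do rewrite !mulrDl.
rewrite !big_split/=; congr (_ + _ + _).
- under eq_bigr do rewrite mulrAC mulrC.
  by rewrite -mulr_sumr sum_successors_eq// mem_successors_add.
- under eq_bigr do rewrite mulr_suml.
  rewrite exchange_big/=; apply: eq_bigr => j _.
  have [xs|xs] := posnP (x (at_phase i)).
    by rewrite pf_eq0// mulr0 !mul0r big1// => y _; rewrite mulr0 mul0r.
  under eq_bigr do rewrite add_unit_eq_add// mulrAC mulrC.
  by rewrite -mulr_sumr sum_successors_eq// mem_successors_move.
- have [xs|xs] := posnP (x (at_phase i)).
    by rewrite pf_eq0// mulr0 !mul0r big1// => y _; rewrite mulr0 mul0r.
  under eq_bigr do rewrite add_unit_eq// mulrAC mulrC.
  by rewrite -mulr_sumr sum_successors_eq// mem_successors_remove.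
Qed.

Let exit_prob_ge0 r (i : 'I_(nphases (svc r))) :
  0 <= 1 - \sum_j next_prob (svc r) i j.
Proof. by rewrite subr_ge0 next_prob_sub. Qed.

Let service_ge0 x r (i : 'I_(nphases (svc r))) :
  0 <= service_rate i * pf C x (at_phase i).
Proof. by rewrite mulr_ge0 ?pf_ge0// ltW ?service_rate_gt0. Qed.

Let rate_term x y r (i : 'I_(nphases (svc r))) : R :=
    (y == x + unit_state (at_phase i))%:R * (nu r * start_prob i)
  + \sum_(j < nphases (svc r))
      (y + unit_state (at_phase i) == x + unit_state (at_phase j))%:R
        * (service_rate i * pf C x (at_phase i) * next_prob (svc r) i j)
  + (y + unit_state (at_phase i) == x)%:R
      * (service_rate i * pf C x (at_phase i)
          * (1 - \sum_(j < nphases (svc r)) next_prob (svc r) i j)).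

Let rate_term_ge0 x y r (i : 'I_(nphases (svc r))) : 0 <= rate_term x y i.
Proof.
rewrite !addr_ge0//.
- by rewrite mulr_ge0// mulr_ge0 ?start_prob_ge0// ltW.
- by apply: sumr_ge0 => j _; rewrite mulr_ge0// mulr_ge0 ?next_prob_ge0.
- by rewrite mulr_ge0// mulr_ge0.
Qed.

Lemma pf_rate_ge0 x y : 0 <= q x y.
Proof. by apply: sumr_ge0 => r _; apply: sumr_ge0 => i _; exact: rate_term_ge0. Qed.

Let rate_term_le x y r (i : 'I_(nphases (svc r))) : rate_term x y i <= q x y.
Proof.
rewrite /pf_rate (bigD1 r)//= (bigD1 i)//= -/(rate_term x y i) -addrA lerDl.
rewrite addr_ge0//; first by apply: sumr_ge0 => j _; exact: rate_term_ge0.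
by apply: sumr_ge0 => r' _; apply: sumr_ge0 => j _; exact: rate_term_ge0.
Qed.

Lemma pf_rate_out x y : y != x -> y \notin successors x -> q x y = 0.
Proof.
move=> yx ys; have ne z : (z == x) || (z \in successors x) -> (y == z) = false.
  move=> hz; apply/negbTE; apply: contraNneq ys => yz; subst z.
  by move: hz; rewrite (negbTE yx).
rewrite /pf_rate big1// => r _; rewrite big1// => i _.
rewrite ne ?mem_successors_add// mul0r add0r.
have [xs|xs] := posnP (x (at_phase i)).
  rewrite pf_eq0// mulr0 !mul0r mulr0 addr0 big1// => j _.
  by rewrite mul0r mulr0.
rewrite add_unit_eq// ne ?mem_successors_remove// mul0r addr0 big1// => j _.
by rewrite add_unit_eq_add// ne ?mem_successors_move// mul0r.
Qed.

Let exitE x : exit_rate q x = generator x (fun y => (y != x)%:R).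
Proof.
rewrite (exit_rateE successors_uniq successors_irr pf_rate_out).
rewrite -sum_successors ?eqxx// big_seq [RHS]big_seq; apply: eq_bigr => y.
by rewrite mem_filter => /andP[-> _]; rewrite mulr1.
Qed.

Let add_unit_neq x s : x + unit_state s != x.
Proof.
apply/eqP => /ffunP/(_ s); rewrite add_stateE unit_stateE eqxx addn1.
by move/eqP; rewrite eqn_leq ltnn.
Qed.

Lemma exit_rate_ge x : \sum_r nu r <= exit_rate q x.
Proof.
rewrite exitE; apply: ler_sum => r _.
apply: (@le_trans _ _ (\sum_(i < nphases (svc r)) nu r * start_prob i)).
  by rewrite -mulr_sumr start_prob_sum1 mulr1.
apply: ler_sum => i _.
rewrite add_unit_neq mulr1 -addrA lerDl addr_ge0//.
  by apply: sumr_ge0 => j _; rewrite mulr_ge0// mulr_ge0 ?next_prob_ge0.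
by rewrite mulr_ge0// mulr_ge0.
Qed.

Lemma exit_rate_le : exists Q, forall x, exit_rate q x <= Q.
Proof.
have [B B0 hB] := phase_capacity_bounded hC svc.
exists (\sum_r \sum_(i < nphases (svc r)) (nu r * start_prob i + service_rate i * B)).
move=> x; rewrite exitE; apply: ler_sum => r _; apply: ler_sum => i _.
have b01 (b : bool) : (b%:R : R) <= 1 by case: b.
rewrite -addrA lerD//.
  by rewrite ler_piMr// mulr_ge0 ?start_prob_ge0// ltW.
set w := service_rate i * _; have w0 : 0 <= w by exact: service_ge0.
apply: (@le_trans _ _ (\sum_j w * next_prob (svc r) i j +
    w * (1 - \sum_j next_prob (svc r) i j))).
  apply: lerD; last by rewrite ler_piMr// mulr_ge0.
  by apply: ler_sum => j _; rewrite ler_piMr// mulr_ge0 ?next_prob_ge0.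
rewrite -mulr_sumr -mulrDr addrC subrK mulr1.
rewrite ler_pM2l ?service_rate_gt0//.
by have /andP[] := hB _ (phase_capacity_pf hC x) (at_phase i).
Qed.

(** * Reachability of the empty state *)

Lemma reachable_trans x y z : reachable q x y -> reachable q y z -> reachable q x z.
Proof.
move=> [p hp <-] [p' hp' <-]; exists (p ++ p'); last by rewrite last_cat.
by rewrite cat_path hp.
Qed.

Let remove_user_neq x s : (0 < x s)%N -> x != remove_user x s.
Proof.
move=> xs; apply/eqP => /ffunP/(_ s); rewrite remove_userE eqxx.
by case: (x s) xs => //= n _ /eqP; rewrite subn1/= eqn_leq ltnn.
Qed.

Lemma reachable_remove x r (i : 'I_(nphases (svc r))) :
  (0 < x (at_phase i))%N -> \sum_j next_prob (svc r) i j < 1 ->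
  reachable q x (remove_user x (at_phase i)).
Proof.
move=> xi hi; exists [:: remove_user x (at_phase i)] => //=.
rewrite remove_user_neq//= andbT; apply: lt_le_trans (rate_term_le _ _ i).
rewrite /rate_term add_unit_eq// eqxx mul1r ltr_wpDl//.
  rewrite addr_ge0//; first by rewrite mulr_ge0// mulr_ge0 ?start_prob_ge0// ltW.
  by apply: sumr_ge0 => j _; rewrite mulr_ge0// mulr_ge0 ?next_prob_ge0.
by rewrite !mulr_gt0 ?service_rate_gt0 ?pf_gt0// subr_gt0.
Qed.

Lemma reachable_move x r (i j : 'I_(nphases (svc r))) :
  (0 < x (at_phase i))%N -> i != j -> 0 < next_prob (svc r) i j ->
  reachable q x (remove_user x (at_phase i) + unit_state (at_phase j)).
Proof.
move=> xi ij pij.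
exists [:: remove_user x (at_phase i) + unit_state (at_phase j)] => //=.
apply/andP; split => //; apply/andP; split.
  apply/eqP => /ffunP/(_ (at_phase i)).
  rewrite add_stateE remove_userE unit_stateE eqxx /at_phase eq_Tagged/= (negbTE ij).
  by rewrite addn0; case: (x _) xi => //= n _ /eqP; rewrite subn1/= eqn_leq ltnn.
apply: lt_le_trans (rate_term_le _ _ i).
rewrite /rate_term; apply: ltr_wpDr; first by rewrite mulr_ge0// mulr_ge0.
apply: ltr_wpDl; first by rewrite mulr_ge0// mulr_ge0 ?start_prob_ge0// ltW.
rewrite (bigD1 j)//=; apply: ltr_wpDr.
  by apply: sumr_ge0 => k _; rewrite mulr_ge0// mulr_ge0 ?next_prob_ge0.
by rewrite add_unit_eq_add// eqxx mul1r !mulr_gt0 ?service_rate_gt0 ?pf_gt0.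
Qed.

Let remaining s : R := remaining_service (d := svc (tag s)) (tagged s).
Let rank s : nat := #|[pred s' : up | remaining s' < remaining s]|.

Let rank_lt s s' : remaining s' < remaining s -> (rank s' < rank s)%N.
Proof.
move=> h; apply: proper_card; apply/properP; split.
  by apply/fintype.subsetP => u; rewrite !inE => /lt_trans; apply.
by exists s'; rewrite !inE ?ltxx.
Qed.

(** Moving a user to a phase of smaller rank decreases it, and the added one makes a departure
    decrease it even from rank zero. *)
Let potential x : nat := (\sum_s x s * (rank s).+1)%N.

Let potential_add x s : potential (x + unit_state s) = (potential x + (rank s).+1)%N.
Proof.
rewrite /potential; under eq_bigr do rewrite add_stateE unit_stateE mulnDl.
rewrite big_split/=; congr addn.
rewrite (bigD1 s)//= eqxx mul1n big1 ?addn0// => u us.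
by rewrite (negbTE us).
Qed.

Let remove_userK x s : (0 < x s)%N -> remove_user x s + unit_state s = x.
Proof. by move=> xs; apply/eqP; rewrite add_unit_eq. Qed.

(* Either service can end at the current phase or, by the equation of the
   remaining service, some next phase has a smaller remaining service. *)
Lemma reachable_empty x : reachable q x 0.
Proof.
have [n] := ubnP (potential x); elim: n x => // n IH x xn.
have [x0|] := pselect (forall s, x s = 0%N).
  by exists [::] => //=; apply/ffunP => s; rewrite x0 ffunE.
move=> /existsNP[[r i]] /eqP; rewrite -lt0n -/(at_phase i) => xi.
have xE := remove_userK xi.
have [hi|hi] := ltP (\sum_j next_prob (svc r) i j) 1.
  apply: reachable_trans (reachable_remove xi hi) (IH _ _).
  rewrite -ltnS; apply: leq_trans xn.
  by rewrite ltnS -{2}xE potential_add addnS ltnS leq_addr.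
have p1 : \sum_j next_prob (svc r) i j = 1.
  by apply/eqP; rewrite eq_le hi next_prob_sub.
have [j pij mij] : exists2 j, 0 < next_prob (svc r) i j &
    remaining_service j < remaining_service i.
  apply: contrapT => hj.
  have : \sum_j next_prob (svc r) i j * remaining_service i <=
         \sum_j next_prob (svc r) i j * remaining_service j.
    apply: ler_sum => j _; have := next_prob_ge0 i j.
    rewrite le_eqVlt => /predU1P[<-|pij]; first by rewrite !mul0r.
    rewrite ler_pM2l// leNgt; apply/negP => mij; apply: hj.
    by exists j.
  rewrite -mulr_suml p1 mul1r [leLHS]remaining_serviceE gerDr leNgt.
  by rewrite invr_gt0 service_rate_gt0.
have ij : i != j by apply: contraTneq mij => ->; rewrite ltxx.
apply: reachable_trans (reachable_move xi ij pij) (IH _ _).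
have rk : (rank (at_phase j) < rank (at_phase i))%N by exact: rank_lt.
rewrite -ltnS; apply: leq_trans xn.
by rewrite ltnS -{2}xE !potential_add ltn_add2l ltnS.
Qed.

(** * Negative drift of the energy *)

Context (eps : R).
Hypothesis eps_gt0 : 0 < eps.

(* Arrivals are raised by [eps] so that every phase has positive load. *)
Definition load r : 'I_(nphases (svc r)) -> R :=
  phase_load (fun i : 'I_(nphases (svc r)) => nu r * start_prob i + eps).

Let arrival_le r (i : 'I_(nphases (svc r))) :
  0 <= nu r * start_prob i <= nu r * start_prob i + eps.
Proof. by rewrite lerDl (ltW eps_gt0) andbT mulr_ge0 ?start_prob_ge0// ltW. Qed.

Let arrival_gt0 r (i : 'I_(nphases (svc r))) : 0 < nu r * start_prob i + eps.
Proof. by rewrite ltr_wpDl// mulr_ge0 ?start_prob_ge0// ltW. Qed.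

Lemma load_gt0 r (i : 'I_(nphases (svc r))) : 0 < load i.
Proof. exact: phase_load_gt0. Qed.

Lemma sum_load r : \sum_i @load r i =
  nu r * mean_service (svc r) + eps * \sum_(i < nphases (svc r)) remaining_service i.
Proof.
rewrite /load /phase_load sum_throughput mean_serviceE !mulr_sumr -big_split/=.
by apply: eq_bigr => i _; rewrite mulrDl mulrA.
Qed.

Hypothesis load_capacity : C (fun r => (1 + eps) * \sum_i @load r i).

Let coef s : R := remaining_service (d := svc (tag s)) (tagged s) / load (tagged s).

Let coef_ge0 s : 0 <= coef s.
Proof. by apply: divr_ge0; [exact/ltW/remaining_service_gt0|exact/ltW/load_gt0]. Qed.

Let total_coef : R := \sum_s coef s.

Let coef_le s : coef s <= total_coef.
Proof. by rewrite /total_coef (bigD1 s)//= lerDl sumr_ge0. Qed.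

Definition energy x : R := \sum_s coef s * (x s)%:R ^+ 2 / 2.

Lemma energy_ge0 x : 0 <= energy x.
Proof. by apply: sumr_ge0 => s _; rewrite divr_ge0// mulr_ge0// sqr_ge0. Qed.

Let energy_diff x y (dx : up -> R) : (forall s, (y s)%:R = (x s)%:R + dx s) ->
  energy y - energy x = \sum_s (coef s * (x s)%:R * dx s + coef s * dx s ^+ 2 / 2).
Proof.
move=> h; rewrite -sumrB; apply: eq_bigr => s _; rewrite h.
by field.
Qed.

Let sum_eq_coef (F : up -> R) s : \sum_u F u * (u == s)%:R = F s.
Proof.
rewrite (bigD1 s)//= eqxx mulr1 big1 ?addr0// => u us.
by rewrite (negbTE us) mulr0.
Qed.

Let energy_add x s :
  energy (x + unit_state s) - energy x <= coef s * (x s)%:R + total_coef.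
Proof.
rewrite (@energy_diff _ _ (fun u => (u == s)%:R)); last first.
  by move=> u; rewrite add_stateE unit_stateE natrD.
rewrite (eq_bigr (fun u => (coef u * (x u)%:R + coef u / 2) * (u == s)%:R)).
  by rewrite sum_eq_coef lerD2l; have := coef_le s; have := coef_ge0 s; lra.
by move=> u _; case: (u == s); rewrite /=; field.
Qed.

Let energy_remove x s : (0 < x s)%N ->
  energy (remove_user x s) - energy x <= - (coef s * (x s)%:R) + total_coef.
Proof.
move=> xs; rewrite (@energy_diff _ _ (fun u => - (u == s)%:R)); last first.
  move=> u; rewrite remove_userE natrB//.
  by case: eqP => // ->.
rewrite (eq_bigr (fun u => (- (coef u * (x u)%:R) + coef u / 2) * (u == s)%:R)).
  by rewrite sum_eq_coef lerD2l; have := coef_le s; have := coef_ge0 s; lra.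
by move=> u _; case: (u == s); rewrite /=; field.
Qed.

Let energy_move x s s' : (0 < x s)%N ->
  energy (remove_user x s + unit_state s') - energy x <=
  coef s' * (x s')%:R - coef s * (x s)%:R + total_coef.
Proof.
move=> xs.
rewrite (@energy_diff _ _ (fun u => (u == s')%:R - (u == s)%:R)); last first.
  move=> u; rewrite add_stateE remove_userE unit_stateE natrD natrB.
    by rewrite addrAC addrA.
  by case: eqP => // ->.
(* The square of a difference of two indicators is at most their sum, also when [s = s']. *)
apply: (@le_trans _ _ (\sum_u ((coef u * (x u)%:R + coef u / 2) * (u == s')%:R
    - (coef u * (x u)%:R - coef u / 2) * (u == s)%:R))).
  apply: ler_sum => u _; have := coef_ge0 u.
  by case: (u == s'); case: (u == s); rewrite /= !expr2; lra.
rewrite sumrB !sum_eq_coef.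
by have := coef_le s; have := coef_le s'; lra.
Qed.

Let share x r : R := \sum_(i < nphases (svc r)) (x (at_phase i))%:R.

(** Test vector for [pf_variational]: the raised load of a type is shared in proportion to its
    users, so that the ratio to [pf] is constant over its occupied phases. Division by zero gives
    zero to a type without users. *)
Let target x (s : up) : R :=
  (1 + eps) * (\sum_i @load (tag s) i) * (x s)%:R / share x (tag s).

Let share_ge0 x r : 0 <= share x r.
Proof. by apply: sumr_ge0. Qed.

Let sum_load_ge0 r : 0 <= \sum_i @load r i.
Proof. by apply: sumr_ge0 => i _; rewrite ltW// load_gt0. Qed.

Let target_capacity x : phase_capacity C (target x).
Proof.
have e0 : 0 <= 1 + eps by rewrite addr_ge0// ltW.
split => [s|].
  by rewrite /target divr_ge0// mulr_ge0// mulr_ge0.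
apply: (capacity_down hC) load_capacity => r.
  by apply: sumr_ge0 => i _; rewrite /target divr_ge0// mulr_ge0// mulr_ge0.
have -> : \sum_(i < nphases (svc r)) target x (at_phase i) =
    (1 + eps) * (\sum_i @load r i) * share x r / share x r.
  by rewrite [X in _ * X / _]/share mulr_sumr mulr_suml.
have [->|s0] := eqVneq (share x r) 0; last by rewrite mulfK.
by rewrite mulr0 mul0r mulr_ge0.
Qed.

(** Apply [type_drift_le] with the bandwidth per user as [theta]: testing against [target] produces
    exactly its load term, up to the factor [1 + eps]. For an empty type both sides vanish. *)
Let type_drift x r :
  \sum_(i < nphases (svc r)) (
    nu r * start_prob i * (coef (at_phase i) * (x (at_phase i))%:R)
    + \sum_(j < nphases (svc r))
        service_rate i * pf C x (at_phase i) * next_prob (svc r) i j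
          * (coef (at_phase j) * (x (at_phase j))%:R)
    - service_rate i * pf C x (at_phase i)
        * (coef (at_phase i) * (x (at_phase i))%:R))
  <= (\sum_(i < nphases (svc r)) (x (at_phase i))%:R
        * (target x (at_phase i) / pf C x (at_phase i))) / (1 + eps) - share x r.
Proof.
have e0 : 0 < 1 + eps by rewrite addr_gt0.
have [X0|X0] := eqVneq (share x r) 0.
  have x0 (i : 'I_(nphases (svc r))) : x (at_phase i) = 0%N.
    apply/eqP; rewrite -(pnatr_eq0 R); move: X0 => /eqP.
    by rewrite psumr_eq0// => /allP/(_ i (mem_index_enum _)).
  rewrite X0 subr0 [leLHS]big1 => [|i _].
    by rewrite big1 ?mul0r// => i _; rewrite x0 mul0r.
  rewrite x0 (pf_eq0 hC (x0 i)) !mulr0 add0r subr0 big1// => j _.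
  by rewrite !mul0r.
have Xgt0 : 0 < share x r by rewrite lt_neqAle eq_sym X0 share_ge0.
have [i0 xi0] : exists i : 'I_(nphases (svc r)), (0 < x (at_phase i))%N.
  apply: contrapT => h; move/eqP: X0; apply; rewrite /share big1// => i _.
  by apply/eqP; rewrite pnatr_eq0 eqn0Ngt; apply/negP => xi; apply: h; exists i.
pose L : R := \sum_(i < nphases (svc r)) pf C x (at_phase i).
have L0 : 0 < L.
  rewrite /L (bigD1 i0)//= ltr_pwDl ?pf_gt0//.
  by apply: sumr_ge0 => j _; exact: pf_ge0.
pose theta := L / share x r.
have theta0 : 0 < theta by rewrite divr_gt0.
have lE (i : 'I_(nphases (svc r))) : pf C x (at_phase i) = theta * (x (at_phase i))%:R.
  apply: (mulIf X0); rewrite [LHS](pf_type_share hC x (at_phase i)) -/L.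
  by rewrite /theta mulrAC divfK// mulrC.
apply: le_trans (@type_drift_le _ (svc r) _ _ (@arrival_le r) (@arrival_gt0 r)
  theta (fun i => (x (at_phase i))%:R) (fun i => pf C x (at_phase i)) theta0 _ lE) _.
  by move=> i.
rewrite lerD2r le_eqVlt; apply/orP; left; apply/eqP.
pose S := \sum_i @load r i; transitivity (S / theta); first by [].
rewrite (eq_bigr (fun i => (1 + eps) * S / share x r / theta
    * (x (at_phase i))%:R)).
  rewrite -mulr_sumr -/(share x r) -/S.
  by field; rewrite !gt_eqF.
move=> i _; rewrite lE /target -/S.
have [->|xi] := posnP (x (at_phase i)); first by rewrite !(mulr0, mul0r).
by rewrite /=; field; rewrite X0 !gt_eqF// ltr0n.
Qed.

Lemma energy_drift : exists2 c : R, 0 < c & exists K, forall x,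
  generator x (fun y => energy y - energy x) <= K - c * \sum_s (x s)%:R.
Proof.
have e0 : 0 < 1 + eps by rewrite addr_gt0.
exists (eps / (1 + eps)); first by rewrite divr_gt0.
have [B B0 hB] := phase_capacity_bounded hC svc.
(* The constant gathers the second-order terms: each jump adds at most [total_coef] to the linear
   part, and bandwidths are at most [B]. *)
exists (\sum_r \sum_(i < nphases (svc r))
  (nu r * start_prob i + service_rate i * B) * total_coef).
move=> x.
pose w r (i : 'I_(nphases (svc r))) := service_rate i * pf C x (at_phase i).
pose cx r (i : 'I_(nphases (svc r))) := coef (at_phase i) * (x (at_phase i))%:R.
have T0 : 0 <= total_coef by apply: sumr_ge0.
apply: (@le_trans _ _ (\sum_r \sum_(i < nphases (svc r)) (
    (nu r * start_prob i * cx r i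
      + \sum_(j < nphases (svc r)) w r i * next_prob (svc r) i j * cx r j
      - w r i * cx r i)
    + (nu r * start_prob i + service_rate i * B) * total_coef))).
  apply: ler_sum => r _; apply: ler_sum => i _.
  have a0 : 0 <= nu r * start_prob i by have /andP[] := arrival_le i.
  have w0 : 0 <= w r i by exact: service_ge0.
  have wB : w r i <= service_rate i * B.
    rewrite /w ler_pM2l ?service_rate_gt0//.
    by have /andP[] := hB _ (phase_capacity_pf hC x) (at_phase i).
  apply: (@le_trans _ _ (nu r * start_prob i * (cx r i + total_coef)
    + \sum_(j < nphases (svc r)) w r i * next_prob (svc r) i j
        * (cx r j - cx r i + total_coef)
    + w r i * (1 - \sum_(j < nphases (svc r)) next_prob (svc r) i j)
        * (- cx r i + total_coef))).
    have [xi|xi] := posnP (x (at_phase i)).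
      have wi : w r i = 0 by rewrite /w (pf_eq0 hC xi) mulr0.
      rewrite -/(w r i) wi !mul0r !addr0 !big1 ?addr0; first last.
      - by move=> j _; rewrite !mul0r.
      - by move=> j _; rewrite !mul0r.
      by rewrite ler_wpM2l// energy_add.
    apply: lerD; first apply: lerD.
    - by rewrite ler_wpM2l// energy_add.
    - apply: ler_sum => j _; rewrite ler_wpM2l//; last exact: energy_move.
      by rewrite mulr_ge0 ?next_prob_ge0.
    - by rewrite ler_wpM2l ?energy_remove// mulr_ge0.
  (* Moves and exits together lose [cx r i] at the full rate [w r i], since their probabilities sum
     to one. *)
  have -> : \sum_(j < nphases (svc r)) w r i * next_prob (svc r) i j
        * (cx r j - cx r i + total_coef) =
      \sum_(j < nphases (svc r)) w r i * next_prob (svc r) i j * cx r j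
      + w r i * (\sum_(j < nphases (svc r)) next_prob (svc r) i j)
          * (total_coef - cx r i).
    rewrite mulr_sumr mulr_suml -big_split/=; apply: eq_bigr => j _; ring.
  have := ler_wpM2r T0 wB; lra.
under eq_bigr do rewrite big_split/=.
rewrite big_split/= addrC lerD2l.
apply: le_trans (ler_sum _ (fun r _ => type_drift x r)) _.
rewrite sumrB -mulr_suml.
(* Testing against [target] leaves [|x| / (1 + eps) - |x|], where [|x|] is the number of users. *)
have := pf_variational hC x (target_capacity x); rewrite !sum_user_phase => hv.
apply: (@le_trans _ _ ((\sum_r share x r) / (1 + eps) - \sum_r share x r)).
  by rewrite lerD2r ler_pM2r ?invr_gt0.
rewrite le_eqVlt; apply/orP; left; apply/eqP.
rewrite /share; field; rewrite gt_eqF//.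
Qed.

End UserNumbers.

(** * From loads in the interior to ergodicity *)

Lemma interior_ray (R : realType) (I : finType) (C : set {ptws I -> R})
    (a b : I -> R) :
  interior C a -> exists2 e : R, 0 < e & C (fun r => (1 + e) * (a r + e * b r)).
Proof.
(* This continuous curve passes through [a] at zero, so it stays in [C] for small positive [t]. *)
move=> hC; pose g (t : R) : {ptws I -> R} := fun r => (1 + t) * (a r + t * b r).
have g0 : g 0 = a by apply/funext => r; rewrite /g addr0 mul0r addr0 mul1r.
have gc : continuous g.
  apply: continuous_ptws => r t; apply: cvgM.
    by apply: cvgD; [exact: cvg_cst|exact: cvg_id].
  apply: cvgD; first exact: cvg_cst.
  by apply: cvgM; [exact: cvg_id|exact: cvg_cst].
have : nbhs (0 : R) (g @^-1` C) by apply: gc; rewrite g0; exact: hC.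
rewrite -nbhs_ballE => -[e /= e0 he]; exists (e / 2); first by rewrite divr_gt0.
apply: he; rewrite /ball/= sub0r normrN gtr0_norm ?divr_gt0//.
by rewrite ltr_pdivrMr// ltr_pMr// ltr1n.
Qed.

Lemma finite_bounded_states (R : realType) (I : finType) (svc : I -> phase_type R)
    (N : nat) :
  exists F : seq (state svc), forall x, x \notin F -> exists s, (N < x s)%N.
Proof.
exists [seq ([ffun s => nat_of_ord (f s)] : state svc) | f : {ffun _ -> _} <- enum {ffun user_phase svc -> 'I_N.+1}] => x.
move=> xF; apply: contrapT => h; move/negP: xF; apply.
apply/mapP; exists [ffun s => inord (x s)]; first by rewrite mem_enum.
apply/ffunP => s; rewrite !ffunE inordK// ltnS leqNgt.
by apply/negP => xs; apply: h; exists s.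
Qed.

Unset Implicit Arguments.

Theorem theorem5 (R : realType) (I : finType) (I_nonempty : (0 < #|I|)%N)
    (C : set {ptws I -> R}) (hC : capacity_set C)
    (nu : I -> R) (nu_gt0 : forall r, 0 < nu r)
    (svc : I -> phase_type R)
    (hrho : interior C (fun r => nu r * mean_service (svc r))) :
  ergodic_from (@pf_rate R I svc C nu) 0.
Proof.
pose M r := \sum_(i < nphases (svc r)) remaining_service i.
have [eps eps0 heps] := interior_ray M hrho.
have load_cap : C (fun r => (1 + eps) * \sum_i @load R I nu svc eps r i).
  by move: heps; congr C; apply/funext => r; rewrite sum_load.
(* Irreducibility goes through the empty state, to which [x] leads and from which [y] is reached. *)
split=> [x y _ hy|o ho].
  exact: reachable_trans (reachable_empty hC nu_gt0 x) hy.
have [c c0 [K drift]] := energy_drift hC nu_gt0 eps0 load_cap.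
have [Q hQ] := exit_rate_le hC svc nu_gt0.
(* Outside the box of states with coordinates at most [N], [c] times the number of users is at least
   [K + Q]: the drift is at most [- Q], hence at most minus the exit rate. *)
pose N := Num.truncn ((K + Q) / c).
have [F hF] := finite_bounded_states svc N.
have nu_sum : 0 < \sum_r nu r.
  have [r _] := card_gt0P I_nonempty.
  rewrite (bigD1 r)//= ltr_pwDl//; apply: sumr_ge0 => r' _; exact: ltW.
refine (foster_positive_recurrent (@successors_uniq R I svc)
  (@successors_irr R I svc) (pf_rate_out hC nu (svc := svc)) (pf_rate_ge0 hC nu_gt0)
  nu_sum (exit_rate_ge hC nu (svc := svc)) (V := energy nu eps) (F := F) _ _ _) => [|x|x _].
- exact: energy_ge0.
- move=> /hF[s xs]; rewrite sum_successors ?subrr//.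
  apply: le_trans (drift x) _.
  have : (K + Q) / c <= \sum_u (x u)%:R.
    apply: le_trans (ltW (truncnS_gt _)) _; rewrite -/N (bigD1 s)//=.
    by rewrite ler_wpDr ?ler_nat//; apply: sumr_ge0.
  by rewrite ler_pdivrMr// mulrC; have := hQ x; lra.
- exact: reachable_trans (reachable_empty hC nu_gt0 x) ho.
Qed.
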